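(* Suppose there is $L>0$ such that $\|\nabla f(u)-\nabla f(v)\|\le L\|u-v\|$ for all $u,v\in\mathbb{R}^n$. Let $(x_k)_{k\ge 0}$ be the iterates generated by the algorithm described in the context, from any initial point $x_0\in\mathbb{R}^n$. Then $\mathbb{E}[\|\nabla f(x_j)\|]$ converges to $0$ as $j\to\infty$, and for any $\epsilon\in(0,1)$ with $p(\epsilon)>0$ and every $k\ge 0$, $$\mathbb{E}\left[\min_{0\le j\le k}\|\nabla f(x_j)\|\right]\le\sqrt{\frac{1}{k+1}\left(c\,\bar\alpha\, M_1\left(\frac{(1-\epsilon)d}{\mathcal{C}n}\right)^2p(\epsilon)\right)^{-1}\bigl(f(x_0)-f^*\bigr)},$$ where $\bar\alpha:=\min\left(1,\frac{2\beta(1-c)}{mM_2L}\right)$.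
   Context: Setting. $f:\mathbb{R}^n\to\mathbb{R}$ is of class $C^2$ (not necessarily convex), and $f^*\in\mathbb{R}$ is the optimal value of $\min_{x\in\mathbb{R}^n}f(x)$. $\|\cdot\|$ is the Euclidean norm for vectors and the operator norm for matrices. $d,m$ are positive integers, much smaller than $n$, with $m$ even. Parameters: $\beta,c\in(0,1)$ and $0<M_1\le M_2$. Algorithm (exact subspace gradients). Input: a deterministic $x_0\in\mathbb{R}^n$, a symmetric matrix $H_0\in\mathbb{R}^{m\times m}$ with $M_1I_m\preceq H_0\preceq M_2I_m$, and an initial $n\times m$ matrix with normalized columns. For $k=0,1,2,\dots$: 1. Sample $Q_k\in\mathbb{R}^{n\times d}$ with independent $N(0,1)$ entries, independent of everything generated before. 2. Set $$P_k=\left[\frac{x_{k-\frac m2+1}}{\|x_{k-\frac m2+1}\|},\frac{Q_{k-\frac m2+1}Q_{k-\frac m2+1}^{\top}\nabla f(x_{k-\frac m2+1})}{\|Q_{k-\frac m2+1}Q_{k-\frac m2+1}^{\top}\nabla f(x_{k-\frac m2+1})\|},\dots,\frac{x_k}{\|x_k\|},\frac{Q_kQ_k^{\top}\nabla f(x_k)}{\|Q_kQ_k^{\top}\nabla f(x_k)\|}\right]\in\mathbb{R}^{n\times m},$$ where any column with zero denominator is replaced by the zero vector. At each iteration the first two columns are dropped and the two new columns are appended at the end; for early iterations, columns with negative indices are taken from the initial matrix. Put $g_k(u):=f(x_k+P_ku)$ for $u\in\mathbb{R}^m$, so $\nabla g_k(0)=P_k^\top\nabla f(x_k)$. 3. $\mathbf{d}_k:=-H_k\nabla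 g_k(0)$. 4. $\alpha_k:=\beta^i$, with $i\in\{0,1,2,\dots\}$ the smallest integer such that $f(x_k+\alpha_kP_k\mathbf{d}_k)\le g_k(0)+c\,\alpha_k\nabla g_k(0)^\top\mathbf{d}_k$. 5. $x_{k+1}:=x_k+\alpha_kP_k\mathbf{d}_k$. 6. With $s=\alpha_k\mathbf{d}_k$ and $y=\nabla g_k(\alpha_k\mathbf{d}_k)-\nabla g_k(0)$, set $\tilde H_{k+1}:=\left(I-\frac{sy^\top}{s^\top y}\right)H_k\left(I-\frac{ys^\top}{s^\top y}\right)+\frac{ss^\top}{s^\top y}$. 7. $H_{k+1}$ is obtained from $\tilde H_{k+1}$ by replacing its eigenvalues larger than $M_2$ by $M_2$ and those smaller than $M_1$ by $M_1$, so $M_1I_m\preceq H_{k+1}\preceq M_2I_m$. (If $s^\top y=0$, $H_{k+1}$ is any symmetric matrix determined by the history and satisfying these bounds.) Constants. $\mathcal{C}_0>0$ and $\mathcal{C}>0$ are constants such that, for a random $Q\in\mathbb{R}^{n\times d}$ with independent $N(0,1)$ entries: (i) for every $\epsilon\in(0,1)$ and $x\in\mathbb{R}^n$, $(1-\epsilon)\|x\|^2\le\|\frac1{\sqrt d}Q^\top x\|^2\le(1+\epsilon)\|x\|^2$ with probability at least $1-2e^{-\mathcal{C}_0\epsilon^2d}$; (ii) $\frac1d\|QQ^\top\|\le\mathcal{C}\frac nd$ with probability at least $1-2e^{-d}$. Set $p(\epsilon):=1-(2e^{-\mathcal{C}_0\epsilon^2d}+2e^{-d})$. Expectations are over all the matrices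 $Q_k$. *)

(* Defs.v *)
From mathcomp Require Import all_boot all_order all_algebra.
From mathcomp Require Import all_classical all_reals all_analysis.

Set Implicit Arguments.
Unset Strict Implicit.
Unset Printing Implicit Defensive.

Import Order.TTheory GRing.Theory Num.Theory.
Import numFieldNormedType.Exports.

Local Open Scope classical_set_scope.
Local Open Scope ring_scope.

(* The norm that the library puts on matrices is the sup norm, hence these
   Euclidean notions on column vectors. *)
Definition dot (R : realType) (n : nat) (u v : 'cV[R]_n) : R :=
  (u^T *m v) 0 0.

Definition enorm (R : realType) (n : nat) (v : 'cV[R]_n) : R :=
  Num.sqrt (dot v v).

Definition opnorm (R : realType) (p q : nat) (A : 'M[R]_(p, q)) : R :=
  sup [set enorm (A *m v) | v in [set v : 'cV[R]_q | enorm v <= 1]].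

(* The zero vector is mapped to itself, since 0^-1 = 0. *)
Definition normalize (R : realType) (n : nat) (v : 'cV[R]_n) : 'cV[R]_n :=
  (enorm v)^-1 *: v.

Definition loewner_le (R : realType) (m : nat) (A B : 'M[R]_m) : Prop :=
  forall u : 'cV[R]_m, dot u (A *m u) <= dot u (B *m u).

Definition sym_between (R : realType) (m : nat) (M1 M2 : R) (A : 'M[R]_m) :
    Prop :=
  [/\ A^T = A, loewner_le M1%:M A & loewner_le A M2%:M].

Definition gradient (R : realType) (n : nat) (f : 'cV[R]_n -> R)
    (x : 'cV[R]_n) : 'cV[R]_n :=
  \col_i 'D_(delta_mx i 0) f x.

Definition hessian (R : realType) (n : nat) (f : 'cV[R]_n -> R)
    (x : 'cV[R]_n) : 'M[R]_n :=
  \matrix_(i, j) 'D_(delta_mx j 0) (fun y => gradient f y i 0) x.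

Definition classC2 (R : realType) (n : nat) (f : 'cV[R]_n -> R) : Prop :=
  [/\ forall x, differentiable f x,
      forall x, differentiable (gradient f) x
    & continuous (hessian f)].

Definition mutually_independent (disp : measure_display)
    (T : measurableType disp) (R : realType) (P : probability T R)
    (I : eqType) (X : I -> {RV P >-> R}) : Prop :=
  forall (J : seq I) (B : I -> set R),
    uniq J -> (forall i, measurable (B i)) ->
    P (\bigcap_(i in [set` J]) (X i @^-1` B i)) =
      (\prod_(i <- J) P (X i @^-1` B i))%E.

Definition iid_std_normal (disp : measure_display)
    (T : measurableType disp) (R : realType) (P : probability T R)
    (I : eqType) (X : I -> {RV P >-> R}) : Prop :=
  (forall i (B : set R), measurable B ->
     distribution P (X i) B = normal_prob 0 1 B) /\
  mutually_independent X.

Definition random_mx (disp : measure_display) (T : measurableType disp)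
    (R : realType) (P : probability T R) (n d : nat)
    (X : 'I_n -> 'I_d -> {RV P >-> R}) (w : T) : 'M[R]_(n, d) :=
  \matrix_(i, j) X i j w.

Definition gaussian_mx (disp : measure_display) (T : measurableType disp)
    (R : realType) (P : probability T R) (n d : nat)
    (X : 'I_n -> 'I_d -> {RV P >-> R}) : Prop :=
  iid_std_normal (fun ij : 'I_n * 'I_d => X ij.1 ij.2).

Definition norm_preservation_const (R : realType) (n d : nat) (C0 : R) :
    Prop :=
  forall (disp : measure_display) (T : measurableType disp)
    (P : probability T R) (X : 'I_n -> 'I_d -> {RV P >-> R}),
    gaussian_mx X ->
    forall (eps : R) (x : 'cV[R]_n), 0 < eps < 1 ->
    ((1 - 2 * expR (- C0 * eps ^+ 2 * d%:R))%:E <=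
     P [set w | ((1 - eps) * enorm x ^+ 2 <=
                 enorm ((Num.sqrt d%:R)^-1 *: ((random_mx X w)^T *m x)) ^+ 2 <=
                 (1 + eps) * enorm x ^+ 2)%R])%E.

Definition opnorm_bound_const (R : realType) (n d : nat) (C : R) : Prop :=
  forall (disp : measure_display) (T : measurableType disp)
    (P : probability T R) (X : 'I_n -> 'I_d -> {RV P >-> R}),
    gaussian_mx X ->
    ((1 - 2 * expR (- d%:R))%:E <=
     P [set w | (d%:R^-1 * opnorm (random_mx X w *m (random_mx X w)^T) <=
                 C * (n%:R / d%:R))%R])%E.

Definition prob_level (R : realType) (d : nat) (C0 eps : R) : R :=
  1 - (2 * expR (- C0 * eps ^+ 2 * d%:R) + 2 * expR (- d%:R)).

(* The sigma-algebra generated by the entries of Q_0, ..., Q_k. *)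
Definition history (disp : measure_display) (T : measurableType disp)
    (R : realType) (P : probability T R) (n d : nat)
    (Q : nat -> 'I_n -> 'I_d -> {RV P >-> R}) (k : nat) : set (set T) :=
  <<s [set A | exists l i j (B : set R),
         [/\ (l <= k)%N, measurable B & A = Q l i j @^-1` B]] >>.

Definition history_measurable (disp : measure_display)
    (T : measurableType disp) (R : realType) (P : probability T R)
    (n d m : nat) (Q : nat -> 'I_n -> 'I_d -> {RV P >-> R}) (k : nat)
    (A : T -> 'M[R]_m) : Prop :=
  forall (a b : 'I_m) (B : set R),
    measurable B -> history Q k ((fun w => A w a b) @^-1` B).

(* The sliding window of columns is read off one infinite sequence of columns:
   those of the initial matrix, then for i = 0, 1, ... the normalizations of
   x_i and of Q_i Q_i^T grad f(x_i).  Each iteration shifts the window by two,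
   so the columns of P_k are the terms of index 2(k+1), ..., 2(k+1) + m - 1. *)
Definition subspace_col (R : realType) (n d m : nat) (f : 'cV[R]_n -> R)
    (Pinit : 'M[R]_(n, m)) (Q : nat -> 'M[R]_(n, d)) (x : nat -> 'cV[R]_n)
    (t : nat) : 'cV[R]_n :=
  if (insub t : option 'I_m) is Some j then col j Pinit
  else let i := (t - m)./2 in
    if odd (t - m) then normalize (Q i *m (Q i)^T *m gradient f (x i))
    else normalize (x i).

Definition subspace_mx (R : realType) (n d m : nat) (f : 'cV[R]_n -> R)
    (Pinit : 'M[R]_(n, m)) (Q : nat -> 'M[R]_(n, d)) (x : nat -> 'cV[R]_n)
    (k : nat) : 'M[R]_(n, m) :=
  \matrix_(i, j) subspace_col f Pinit Q x (k.+1.*2 + j) i 0.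

Definition armijo (R : realType) (m : nat) (c : R) (g : 'cV[R]_m -> R)
    (dir : 'cV[R]_m) (alpha : R) : Prop :=
  g (alpha *: dir) <= g 0 + c * alpha * dot (gradient g 0) dir.

Definition armijo_exponent (R : realType) (m : nat) (beta c : R)
    (g : 'cV[R]_m -> R) (dir : 'cV[R]_m) (i : nat) : Prop :=
  armijo c g dir (beta ^+ i) /\
  forall i', (i' < i)%N -> ~ armijo c g dir (beta ^+ i').

Definition bfgs_update (R : realType) (m : nat) (H : 'M[R]_m)
    (s y : 'cV[R]_m) : 'M[R]_m :=
  let r := (dot s y)^-1 in
  (1%:M - r *: (s *m y^T)) *m H *m (1%:M - r *: (y *m s^T)) +
  r *: (s *m s^T).

(* B is A with its eigenvalues clamped to [M1, M2], expressed on a spectral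
   decomposition of A. *)
Definition eigen_clamp (R : realType) (m : nat) (M1 M2 : R)
    (A B : 'M[R]_m) : Prop :=
  exists (U : 'M[R]_m) (lam : 'rV[R]_m),
    [/\ U *m U^T = 1%:M,
        A = U *m diag_mx lam *m U^T
      & B = U *m diag_mx (map_mx (fun l => Num.max M1 (Num.min l M2)) lam)
              *m U^T].

(* One iteration, from (x_k, H_k) to (x_{k+1}, H_{k+1}) = (x', H');
   Hdeg is the matrix used as H_{k+1} in the degenerate case s^T y = 0. *)
Definition quasi_newton_step (R : realType) (n m : nat)
    (beta c M1 M2 : R) (f : 'cV[R]_n -> R) (x : 'cV[R]_n)
    (Pk : 'M[R]_(n, m)) (H Hdeg : 'M[R]_m) (x' : 'cV[R]_n) (H' : 'M[R]_m) :
    Prop :=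
  let g := fun u : 'cV[R]_m => f (x + Pk *m u) in
  let dir := - (H *m gradient g 0) in
  exists2 i : nat, armijo_exponent beta c g dir i &
    let alpha := beta ^+ i in
    let s := alpha *: dir in
    let y := gradient g s - gradient g 0 in
    x' = x + alpha *: (Pk *m dir) /\
    (if dot s y == 0 then H' = Hdeg
     else eigen_clamp M1 M2 (bfgs_update H s y) H').

Definition subspace_qn_run (R : realType) (n d m : nat)
    (beta c M1 M2 : R) (f : 'cV[R]_n -> R) (x0 : 'cV[R]_n) (H0 : 'M[R]_m)
    (Pinit : 'M[R]_(n, m)) (Q : nat -> 'M[R]_(n, d)) (Hdeg : nat -> 'M[R]_m)
    (x : nat -> 'cV[R]_n) (H : nat -> 'M[R]_m) : Prop :=
  [/\ x 0%N = x0, H 0%N = H0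
    & forall k, quasi_newton_step beta c M1 M2 f (x k)
        (subspace_mx f Pinit Q x k) (H k) (Hdeg k) (x k.+1) (H k.+1)].

(* Main.v *)
Require Import Defs.
From HB Require Import structures.
From mathcomp Require Import all_boot all_order all_algebra.
From mathcomp Require Import all_classical all_reals all_analysis.
From mathcomp Require Import measurable_realfun zify ring lra.

Set Implicit Arguments.
Unset Strict Implicit.
Unset Printing Implicit Defensive.

Import Order.TTheory GRing.Theory Num.Theory.
Import numFieldNormedType.Exports.

Local Open Scope classical_set_scope.
Local Open Scope ring_scope.

(** The proof compares two readings of the decrease of [f] along a run.

    Pointwise, [f] decreases at step [j] by at least
    [c * abar * M1 * |P_j^T grad f(x_j)|^2]: the Armijo test gives this with
    the accepted step length in place of [abar], and the descent lemma shows
    that backtracking never stops below [abar], since [|P_j u|^2 <= m |u|^2]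
    and [|H_j g|^2 <= M2 <g, H_j g>] ([quasi_newton_step_decrease]).  Summing,
    the squared subspace gradients have total at most a constant times
    [f x0 - fstar] on every sample path ([newest_component_sum]).  The last
    column of [P_j] is [Q_j Q_j^T grad f(x_j)], normalized, so
    [|P_j^T g|^2] is at least [|Q_j^T g|^4 / |Q_j Q_j^T g|^2] for
    [g = grad f(x_j)]; this quantity is called the newest component.

    In expectation, [x_j] depends on [Q_0, ..., Q_(j-1)] only and [Q_j] is
    independent of these, so the expected newest component can be bounded
    with [g] frozen ([freezing], which is Tonelli's theorem on the product of
    the two sigma-algebras).  A bound [kappa * |g|^2] valid for each fixed [g]
    hence gives
    [sum_j E |grad f(x_j)|^2 <= (c * abar * M1 * kappa)^-1 (f x0 - fstar)]
    ([sum_expected_gradient_le]).  Two values of [kappa] are used.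

    - For the rate, the concentration constants give
      [kappa = ((1 - eps) d / (C n))^2 p(eps)].  The minimum of the first
      [k + 1] gradient norms has a square below their mean square, and
      [E Z <= sqrt (E Z^2)] concludes.

    - Convergence to [0] is claimed even when [p(eps) <= 0] for every [eps], so
      it needs another [kappa > 0].  With positive probability, uniformly in
      [g], every entry in row [i] of [Q] has the sign of [g_i] and a modulus in
      [[1, 2]]; on that event nothing cancels in [Q^T g] and the newest
      component is at least [|g|^2 / (4 n)].  The terms of a convergent series
      tend to [0].

    Freezing requires [x_j] to be measurable for the sigma-algebra of
    [Q_0, ..., Q_(j-1)].  The delicate step is the clamping of eigenvalues,
    given only as a relation: it is nonexpansive for the Frobenius norm on the
    matrices where it is defined ([fro2_eigen_clamp_le]), which makes its
    output measurable ([measurable_fun_lipschitz]). *)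

(** * Euclidean geometry of column vectors *)

Section Euclid.
Variable R : realType.
Implicit Types n p q : nat.

Lemma dotE n (u v : 'cV[R]_n) : dot u v = \sum_i u i 0 * v i 0.
Proof. by rewrite /dot mxE; apply: eq_bigr => i _; rewrite mxE. Qed.

Lemma dotC n (u v : 'cV[R]_n) : dot u v = dot v u.
Proof. by rewrite !dotE; apply: eq_bigr => i _; rewrite mulrC. Qed.

Lemma dotDr n (u v w : 'cV[R]_n) : dot u (v + w) = dot u v + dot u w.
Proof. by rewrite /dot mulmxDr mxE. Qed.

Lemma dotZr n a (u v : 'cV[R]_n) : dot u (a *: v) = a * dot u v.
Proof. by rewrite /dot -scalemxAr mxE. Qed.

Lemma dotNr n (u v : 'cV[R]_n) : dot u (- v) = - dot u v.
Proof. by rewrite -scaleN1r dotZr mulN1r. Qed.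

Lemma dotDl n (u v w : 'cV[R]_n) : dot (v + w) u = dot v u + dot w u.
Proof. by rewrite dotC dotDr !(dotC u). Qed.

Lemma dotZl n a (u v : 'cV[R]_n) : dot (a *: v) u = a * dot v u.
Proof. by rewrite dotC dotZr (dotC u). Qed.

Lemma dotNl n (u v : 'cV[R]_n) : dot (- v) u = - dot v u.
Proof. by rewrite dotC dotNr (dotC u). Qed.

Lemma dot_mulmx p q (u : 'cV[R]_p) (A : 'M[R]_(p, q)) (v : 'cV[R]_q) :
  dot u (A *m v) = dot (A^T *m u) v.
Proof. by rewrite /dot trmx_mul trmxK mulmxA. Qed.

Lemma dot_ge0 n (v : 'cV[R]_n) : 0 <= dot v v.
Proof. by rewrite dotE sumr_ge0// => i _; rewrite -expr2 sqr_ge0. Qed.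

Lemma enorm_ge0 n (v : 'cV[R]_n) : 0 <= enorm v.
Proof. exact: sqrtr_ge0. Qed.

Lemma enorm_sqr n (v : 'cV[R]_n) : enorm v ^+ 2 = dot v v.
Proof. by rewrite sqr_sqrtr ?dot_ge0. Qed.

Lemma enormZ n a (v : 'cV[R]_n) : enorm (a *: v) = `|a| * enorm v.
Proof.
by rewrite /enorm dotZl dotZr mulrA -expr2 sqrtrM ?sqr_ge0// sqrtr_sqr.
Qed.

Lemma enorm0 n : enorm (0 : 'cV[R]_n) = 0.
Proof. by rewrite -(scale0r 0) enormZ normr0 mul0r. Qed.

Lemma cauchy_schwarz_dot n (u v : 'cV[R]_n) :
  dot u v ^+ 2 <= dot u u * dot v v.
Proof.
have [v0|v0] := eqVneq (dot v v) 0.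
  have vi i : v i 0 = 0.
    apply/eqP; rewrite -sqrf_eq0 expr2; move/eqP: v0; rewrite dotE psumr_eq0.
      by move=> /allP /(_ i (mem_index_enum _)).
    by move=> j _; rewrite -expr2 sqr_ge0.
  by rewrite v0 mulr0 (_ : dot u v = 0) ?expr0n// dotE big1// => i _; rewrite vi mulr0.
have vp : 0 < dot v v by rewrite lt_def v0 dot_ge0.
(* The component of [u] orthogonal to [v], scaled by [dot v v]. *)
have := dot_ge0 (dot v v *: u - dot u v *: v).
rewrite !(dotDl, dotDr, dotNl, dotNr, dotZl, dotZr) (dotC v u) => h.
rewrite -(ler_pM2l vp) -subr_ge0; apply: le_trans h _.
by rewrite le_eqVlt; apply/orP; left; apply/eqP; ring.
Qed.

Lemma dot_le_enorm n (u v : 'cV[R]_n) : dot u v <= enorm u * enorm v.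
Proof.
rewrite /enorm -sqrtrM ?dot_ge0//; apply: le_trans (ler_norm _) _.
by rewrite -sqrtr_sqr ler_wsqrtr// cauchy_schwarz_dot.
Qed.

Definition fro2 p q (A : 'M[R]_(p, q)) : R := \sum_i \sum_j A i j ^+ 2.

Lemma fro2_ge0 p q (A : 'M[R]_(p, q)) : 0 <= fro2 A.
Proof. by rewrite !sumr_ge0// => i _; rewrite sumr_ge0// => j _; rewrite sqr_ge0. Qed.

Lemma fro2_tr p q (A : 'M[R]_(p, q)) : fro2 A^T = fro2 A.
Proof.
by rewrite /fro2 exchange_big; apply: eq_bigr => i _; apply: eq_bigr => j _; rewrite mxE.
Qed.

Lemma dot_mulmx_fro2 p q (A : 'M[R]_(p, q)) (v : 'cV[R]_q) :
  dot (A *m v) (A *m v) <= fro2 A * dot v v.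
Proof.
rewrite [leLHS]dotE mulr_suml ler_sum// => i _; rewrite -expr2.
have -> : (A *m v) i 0 = dot (row i A)^T v.
  by rewrite dotE mxE; apply: eq_bigr => j _; rewrite !mxE.
apply: le_trans (cauchy_schwarz_dot _ _) _.
rewrite le_eqVlt; apply/orP; left; apply/eqP; congr (_ * _); rewrite dotE; apply: eq_bigr => j _.
by rewrite !mxE expr2.
Qed.

Lemma enorm_normalize n (v : 'cV[R]_n) : enorm (normalize v) <= 1.
Proof.
rewrite enormZ normfV ger0_norm ?enorm_ge0//.
by have [->|v0] := eqVneq (enorm v) 0; rewrite ?invr0 ?mul0r ?ler01 ?mulVf.
Qed.

Lemma opnorm_has_sup p q (A : 'M[R]_(p, q)) :
  has_sup [set enorm (A *m v) | v in [set v : 'cV[R]_q | enorm v <= 1]].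
Proof.
split; first by exists (enorm (A *m 0)), 0 => //=; rewrite enorm0 ler01.
exists (Num.sqrt (fro2 A)) => _ [v /= v1 <-].
rewrite ler_wsqrtr//; apply: le_trans (dot_mulmx_fro2 _ _) _.
rewrite ler_piMr ?fro2_ge0// -enorm_sqr expr_le1// enorm_ge0//.
Qed.

Lemma enorm_mulmx_opnorm p q (A : 'M[R]_(p, q)) (v : 'cV[R]_q) :
  enorm (A *m v) <= opnorm A * enorm v.
Proof.
have [v0|v0] := eqVneq (enorm v) 0.
  have : enorm (A *m v) <= Num.sqrt (fro2 A * dot v v).
    by rewrite ler_wsqrtr// dot_mulmx_fro2.
  by rewrite -enorm_sqr v0 expr0n/= mulr0 sqrtr0 mulr0.
have vp : 0 < enorm v by rewrite lt_def v0 enorm_ge0.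
rewrite -ler_pdivrMr//.
have -> : enorm (A *m v) / enorm v = enorm (A *m normalize v).
  by rewrite -scalemxAr enormZ normfV ger0_norm ?enorm_ge0// mulrC.
apply: sup_upper_bound; first exact: opnorm_has_sup.
by exists (normalize v) => //=; exact: enorm_normalize.
Qed.

Lemma opnorm_leP p q (A : 'M[R]_(p, q)) t :
  opnorm A <= t <-> (forall v : 'cV[R]_q, enorm v <= 1 -> enorm (A *m v) <= t).
Proof.
split=> [h v v1|h]; last first.
  by apply: ge_sup; [case: (opnorm_has_sup A)|move=> _ [v /= v1 <-]; exact: h].
apply: le_trans h; apply: sup_upper_bound; first exact: opnorm_has_sup.
by exists v.
Qed.

(** Expanding the nonnegative form of [H] at [g - M2^-1 H g]. *)
Lemma sqr_mulmx_le_form m (M2 : R) (H : 'M[R]_m) (g : 'cV[R]_m) :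
  0 < M2 -> H^T = H -> (forall u, 0 <= dot u (H *m u)) ->
  loewner_le H M2%:M -> dot (H *m g) (H *m g) <= M2 * dot g (H *m g).
Proof.
move=> M20 Hs H0 HM; have := H0 (g - M2^-1 *: (H *m g)).
have := HM (H *m g); rewrite mul_scalar_mx dotZr.
rewrite mulmxBr -scalemxAr !(dotDl, dotDr, dotNl, dotNr, dotZl, dotZr).
have -> : dot g (H *m (H *m g)) = dot (H *m g) (H *m g) by rewrite dot_mulmx Hs.
set a := dot (H *m g) (H *m g); set b := dot g _; set e := dot _ (H *m (H *m g)).
move=> h1 h2.
have h3 : M2^-1 * (M2^-1 * e) <= M2^-1 * a.
  by rewrite ler_pM2l ?invr_gt0// mulrC ler_pdivrMr// mulrC.
have : 0 <= b - M2^-1 * a by lra.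
by rewrite subr_ge0 mulrC ler_pdivrMr// mulrC.
Qed.

End Euclid.

(** * Smooth functions along lines and subspaces *)

Section Smooth.
Variable R : realType.
Implicit Types n p q : nat.

Lemma derive_dot_gradient n (f : 'cV[R]_n -> R) (z v : 'cV[R]_n) :
  differentiable f z -> 'D_v f z = dot (gradient f z) v.
Proof.
move=> df; rewrite deriveE// dotE.
have {1}-> : v = \sum_i v i 0 *: (delta_mx i 0 : 'cV[R]_n).
  by rewrite {1}[v]matrix_sum_delta; apply: eq_bigr => i _; rewrite big_ord1.
rewrite linear_sum; apply: eq_bigr => i _.
by rewrite linearZ/= mxE deriveE// mulrC.
Qed.

(** The difference quotients of [u |-> f (x + A u)] in direction [v] are those
    of [f] in direction [A v]. *)
Lemma gradient_affine n m (f : 'cV[R]_n -> R) (x : 'cV[R]_n)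
    (A : 'M[R]_(n, m)) (u : 'cV[R]_m) :
  (forall z, differentiable f z) ->
  gradient (fun u => f (x + A *m u)) u = A^T *m gradient f (x + A *m u).
Proof.
move=> df; apply/colP => i; rewrite mxE.
have -> : 'D_(delta_mx i 0) (fun u => f (x + A *m u)) u =
          'D_(A *m delta_mx i 0) f (x + A *m u).
  rewrite /derive /=; set q1 := (fun h : R => _); set q2 := (fun h : R => _).
  suff -> : q1 = q2 by [].
  by apply/funext => h; rewrite /q1 /q2/= mulmxDr addrCA scalemxAr.
rewrite derive_dot_gradient// dot_mulmx dotE (bigD1 i)//= big1 ?addr0.
  by rewrite !mxE !eqxx mulr1.
by move=> j ji; rewrite !mxE (negbTE ji) mulr0.
Qed.

Lemma is_derive_line n (f : 'cV[R]_n -> R) (x v : 'cV[R]_n) (t : R) :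
  (forall z, differentiable f z) ->
  is_derive t 1 (fun s : R => f (x + s *: v))
    (dot (gradient f (x + t *: v)) v).
Proof.
move=> df.
have E (h : R) : x + (h *: 1 + t) *: v = h *: v + (x + t *: v).
  by rewrite scalerDl [h *: 1]mulr1 addrCA.
apply: DeriveDef.
  rewrite /derivable /=; under eq_fun do rewrite E.
  exact: (@diff_derivable _ _ _ f (x + t *: v) v (df _)).
by rewrite /derive /=; under eq_fun do rewrite E; rewrite -derive_dot_gradient.
Qed.

(** The remainder of the linear approximation, corrected by the quadratic
    upper bound, decreases along the segment. *)
Lemma descent_lemma n (f : 'cV[R]_n -> R) (L : R) (x v : 'cV[R]_n) :
  (forall z, differentiable f z) ->
  (forall u w, enorm (gradient f u - gradient f w) <= L * enorm (u - w)) ->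
  f (x + v) <= f x + dot (gradient f x) v + L / 2 * dot v v.
Proof.
move=> df hL.
pose psi (t : R) := f (x + t *: v) - (t * dot (gradient f x) v)
   - L / 2 * dot v v * t ^+ 2.
pose dpsi (t : R) := dot (gradient f (x + t *: v)) v - dot (gradient f x) v
   - L * dot v v * t.
have dP (t : R) : is_derive t (1:R) psi (dpsi t).
  have H := is_derive_line x v t df.
  rewrite /psi /dpsi; apply: is_derive_eq.
  set G := dot _ v; have sE (a b : R) : a *: (b : R^o) = a * b by []; rewrite !sE !(mulr1, mulr0).
  by field.
have [|c] := @MVT R psi dpsi 0 1 ltr01 (fun t _ => dP t).
  by apply: derivable_within_continuous => t _; case: (dP t).
rewrite in_itv/= => /andP[c0 _].
rewrite subr0 mulr1 => E.
have : dpsi c <= 0.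
  rewrite /dpsi subr_le0 -dotNl -dotDl.
  apply: le_trans (dot_le_enorm _ _) _.
  apply: le_trans (ler_wpM2r (enorm_ge0 _) (hL _ _)) _.
  rewrite addrC addKr enormZ gtr0_norm// -enorm_sqr.
  by rewrite le_eqVlt; apply/orP; left; apply/eqP; ring.
rewrite -E /psi !scale1r scale0r addr0; lra.
Qed.

Lemma ereal_inf_range_le T (f : T -> R) (l : R) :
  ereal_inf (range (fun x => (f x)%:E)) = l%:E -> forall x, l <= f x.
Proof.
by move=> h x; rewrite -lee_fin -h; apply: ereal_inf_lbound; exists x.
Qed.

End Smooth.

(** * Sufficient decrease along a run *)

Section Run.
Variable R : realType.
Implicit Types n m d p q : nat.

Lemma dot_diag_mx m (lam : 'rV[R]_m) (u : 'cV[R]_m) :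
  dot u (diag_mx lam *m u) = \sum_i lam 0 i * u i 0 ^+ 2.
Proof.
rewrite dotE; apply: eq_bigr => i _.
by rewrite mul_diag_mx mxE; ring.
Qed.

Lemma eigen_clamp_sym_between m (M1 M2 : R) (A B : 'M[R]_m) :
  M1 <= M2 -> eigen_clamp M1 M2 A B -> sym_between M1 M2 B.
Proof.
move=> M12 [U [lam [UU _ ->]]].
set mu := map_mx _ lam.
have muP i : M1 <= mu 0 i <= M2.
  by rewrite mxE le_max lexx/= ge_max M12/= ge_min lexx orbT.
have form u : dot u (U *m diag_mx mu *m U^T *m u) =
    \sum_i mu 0 i * (U^T *m u) i 0 ^+ 2.
  by rewrite -!mulmxA dot_mulmx dot_diag_mx.
have norm a (u : 'cV[R]_m) :
    dot u (a%:M *m u) = \sum_i a * (U^T *m u) i 0 ^+ 2.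
  rewrite mul_scalar_mx dotZr -mulr_sumr; congr (_ * _).
  have -> : \sum_i (U^T *m u) i 0 ^+ 2 = dot (U^T *m u) (U^T *m u).
    by rewrite dotE; apply: eq_bigr => i _; rewrite expr2.
  by rewrite -[in RHS]dot_mulmx mulmxA UU mul1mx.
split.
- by rewrite !trmx_mul trmxK tr_diag_mx mulmxA.
- move=> u; rewrite form norm ler_sum// => i _.
  by rewrite ler_wpM2r ?sqr_ge0//; case/andP: (muP i).
- move=> u; rewrite form norm ler_sum// => i _.
  by rewrite ler_wpM2r ?sqr_ge0//; case/andP: (muP i).
Qed.

Lemma enorm_subspace_col n d m (f : 'cV[R]_n -> R) (Pinit : 'M[R]_(n, m))
    (Q : nat -> 'M[R]_(n, d)) (x : nat -> 'cV[R]_n) t :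
  (forall j, enorm (col j Pinit) = 1) ->
  enorm (subspace_col f Pinit Q x t) <= 1.
Proof.
move=> hP; rewrite /subspace_col; case: insub => [j|]; first by rewrite hP.
by case: ifP => _; exact: enorm_normalize.
Qed.

Lemma fro2_subspace_mx n d m (f : 'cV[R]_n -> R) (Pinit : 'M[R]_(n, m))
    (Q : nat -> 'M[R]_(n, d)) (x : nat -> 'cV[R]_n) k :
  (forall j, enorm (col j Pinit) = 1) ->
  fro2 (subspace_mx f Pinit Q x k) <= m%:R.
Proof.
move=> hP; rewrite -fro2_tr /fro2.
rewrite -[m in leRHS](card_ord m) -sum1_card natr_sum ler_sum// => j _.
have := enorm_subspace_col f Q x (k.+1.*2 + j) hP.
set v := subspace_col _ _ _ _ _ => v1.
have -> : \sum_i (subspace_mx f Pinit Q x k)^T j i ^+ 2 = enorm v ^+ 2.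
  by rewrite enorm_sqr dotE; apply: eq_bigr => i _; rewrite !mxE expr2.
by rewrite expr_le1// enorm_ge0.
Qed.

(** The newest column of [P_k] is the normalized random projection of the
    current gradient; it alone controls the subspace gradient from below. *)
Definition newest_component n d (Q : 'M[R]_(n, d)) (g : 'cV[R]_n) : R :=
  dot (normalize (Q *m Q^T *m g)) g ^+ 2.

Lemma newest_component_le n d m (f : 'cV[R]_n -> R) (Pinit : 'M[R]_(n, m))
    (Q : nat -> 'M[R]_(n, d)) (x : nat -> 'cV[R]_n) k g :
  (0 < m)%N -> g = gradient f (x k) ->
  newest_component (Q k) g <=
  dot ((subspace_mx f Pinit Q x k)^T *m g) ((subspace_mx f Pinit Q x k)^T *m g).
Proof.
move=> m0 gE.
have lt : (m.-1 < m)%N by rewrite prednK.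
rewrite [leRHS]dotE (bigD1 (Ordinal lt))//= -expr2.
have -> : ((subspace_mx f Pinit Q x k)^T *m g) (Ordinal lt) 0 =
    dot (normalize (Q k *m (Q k)^T *m g)) g.
  rewrite mxE dotE; apply: eq_bigr => i _; rewrite !mxE/= /subspace_col.
  (* The last column of the window has odd index [2 k + 1] past the initial
     ones, which designates the projected gradient at [x_k]. *)
  have -> : (k.+1.*2 + m.-1)%N = (k.*2.+1 + m)%N.
    by rewrite doubleS -[in RHS](prednK m0) !addSn addnS.
  rewrite insubF ?addnK/=; last by rewrite ltnNge leq_addl.
  by rewrite odd_double/= uphalf_double -gE !mxE.
by rewrite lerDl sumr_ge0// => j _; rewrite -expr2 sqr_ge0.
Qed.

(** Armijo's condition holds for every step below
    [2 (1 - c) / (m M2 L)] by the descent lemma, so the rejected step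
    [beta ^+ i.-1] exceeds that threshold. *)
Lemma quasi_newton_step_decrease n m (beta c M1 M2 L : R)
    (f : 'cV[R]_n -> R) (x x' : 'cV[R]_n) (Pk : 'M[R]_(n, m))
    (H Hdeg H' : 'M[R]_m) :
  (0 < m)%N -> 0 < beta < 1 -> 0 < c < 1 -> 0 < M1 -> M1 <= M2 -> 0 < L ->
  (forall z, differentiable f z) ->
  (forall u w, enorm (gradient f u - gradient f w) <= L * enorm (u - w)) ->
  fro2 Pk <= m%:R -> sym_between M1 M2 H ->
  quasi_newton_step beta c M1 M2 f x Pk H Hdeg x' H' ->
  c * Num.min 1 (2 * beta * (1 - c) / (m%:R * M2 * L)) * M1 *
    dot (Pk^T *m gradient f x) (Pk^T *m gradient f x) <= f x - f x'.
Proof.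
move=> m0 /andP[b0 b1] /andP[c0 c1] M10 M12 L0 df hL hP [Hs HM1 HM2] [i [Ai Ni] [-> _]].
have M20 : 0 < M2 by apply: lt_le_trans M12.
have m0R : 0 < m%:R :> R by rewrite ltr0n.
move: Ai Ni; rewrite /armijo mulmx0 addr0 !gradient_affine// mulmx0 addr0.
set g := Pk^T *m gradient f x.
set q := dot g (H *m g).
have q0 : M1 * dot g g <= q.
  by have := HM1 g; rewrite mul_scalar_mx dotZr.
have qge0 : 0 <= q by apply: le_trans q0; rewrite mulr_ge0 ?dot_ge0// ltW.
have gd : dot g (- (H *m g)) = - q by rewrite dotNr.
rewrite gd; set D := Pk *m - (H *m g).
have DE a : Pk *m (a *: - (H *m g)) = a *: D by rewrite -scalemxAr.
rewrite !DE => Ai Ni.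
have ai0 j : 0 < beta ^+ j by rewrite exprn_gt0.
have DD : dot D D <= m%:R * (M2 * q).
  apply: le_trans (dot_mulmx_fro2 _ _) _.
  rewrite dotNl dotNr opprK ler_pM ?fro2_ge0 ?dot_ge0//.
  apply: sqr_mulmx_le_form => // u.
  by apply: le_trans (HM1 u); rewrite mul_scalar_mx dotZr mulr_ge0 ?dot_ge0// ltW.
have gD : dot (gradient f x) D = - q by rewrite dot_mulmx.
set abar := Num.min _ _.
(* When [q = 0] the subspace gradient vanishes and any step length gives the
   required decrease. *)
have abar_le : q = 0 \/ abar <= beta ^+ i.
  case: i Ai Ni => [|i] Ai Ni.
    by right; rewrite expr0 ge_min lexx.
  have [->|qN0] := eqVneq q 0; [by left|right].
  have qp : 0 < q by rewrite lt_def qN0.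
  have /negP := Ni i (ltnSn i); rewrite DE -ltNge => hi.
  have hd := descent_lemma x (beta ^+ i *: D) df hL.
  move: hd; rewrite !(dotZl, dotZr) gD => hd.
  have h1 : (1 - c) * q * beta ^+ i < L / 2 * (beta ^+ i * (beta ^+ i * dot D D)).
    by have := lt_le_trans hi hd; rewrite -subr_gt0 => h; rewrite -subr_gt0; apply: lt_le_trans h _; lra.
  have h2 : L / 2 * (beta ^+ i * (beta ^+ i * dot D D)) <=
            L / 2 * (beta ^+ i * (beta ^+ i * (m%:R * (M2 * q)))).
    by rewrite !ler_wpM2l// ?ltW// ?divr_gt0.
  have h3 : 2 * (1 - c) < m%:R * M2 * L * beta ^+ i.
    rewrite -(ltr_pM2r qp) -(ltr_pM2r (ai0 i)).
    by have := lt_le_trans h1 h2; lra.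
  rewrite ge_min; apply/orP; right.
  rewrite ler_pdivrMr ?mulr_gt0// exprS.
  have -> : beta * beta ^+ i * (m%:R * M2 * L) = beta * (m%:R * M2 * L * beta ^+ i) by ring.
  have -> : 2 * beta * (1 - c) = beta * (2 * (1 - c)) by ring.
  by rewrite ler_pM2l// ltW.
have abar0 : 0 < abar by rewrite lt_min ltr01/= divr_gt0 ?mulr_gt0// subr_gt0.
have key : abar * q <= beta ^+ i * q.
  by case: abar_le => [->|h]; rewrite ?mulr0// ler_wpM2r.
have h4 : c * (abar * (M1 * dot g g)) <= c * (beta ^+ i * q).
  by rewrite ler_pM2l//; apply: le_trans key; rewrite ler_pM2l.
by move: Ai; lra.
Qed.

Lemma subspace_qn_run_sym_between n d m (beta c M1 M2 : R) (f : 'cV[R]_n -> R)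
    x0 H0 (Pinit : 'M[R]_(n, m)) (Q : nat -> 'M[R]_(n, d)) Hdeg x H k :
  M1 <= M2 -> sym_between M1 M2 H0 -> (forall k, sym_between M1 M2 (Hdeg k)) ->
  subspace_qn_run beta c M1 M2 f x0 H0 Pinit Q Hdeg x H ->
  sym_between M1 M2 (H k).
Proof.
move=> M12 hH0 hHd [_ HE step]; case: k => [|k]; first by rewrite HE.
have [i _ [_]] := step k; case: ifP => _; first by move=> ->.
exact: eigen_clamp_sym_between.
Qed.

Lemma newest_component_sum n d m (beta c M1 M2 L fstar : R)
    (f : 'cV[R]_n -> R) x0 H0 (Pinit : 'M[R]_(n, m))
    (Q : nat -> 'M[R]_(n, d)) Hdeg x H k :
  (0 < m)%N -> 0 < beta < 1 -> 0 < c < 1 -> 0 < M1 -> M1 <= M2 -> 0 < L ->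
  (forall z, differentiable f z) ->
  (forall u w, enorm (gradient f u - gradient f w) <= L * enorm (u - w)) ->
  (forall z, fstar <= f z) ->
  (forall j, enorm (col j Pinit) = 1) ->
  sym_between M1 M2 H0 -> (forall k, sym_between M1 M2 (Hdeg k)) ->
  subspace_qn_run beta c M1 M2 f x0 H0 Pinit Q Hdeg x H ->
  c * Num.min 1 (2 * beta * (1 - c) / (m%:R * M2 * L)) * M1 *
    \sum_(j < k) newest_component (Q j) (gradient f (x j)) <= f x0 - fstar.
Proof.
move=> m0 hb hc M10 M12 L0 df hL hfs hP hH0 hHd hrun.
have [xE _ step] := hrun.
set K := c * _ * _.
have K0 : 0 <= K.
  have M20 : 0 < M2 by apply: lt_le_trans M12.
  have m0R : 0 < m%:R :> R by rewrite ltr0n.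
  case/andP: hb => b0 b1; case/andP: hc => c0 c1.
  rewrite !mulr_ge0 ?(ltW c0) ?(ltW M10)// le_min ler01/=.
  by rewrite divr_ge0 ?mulr_ge0// ?(ltW b0) ?(ltW M20) ?(ltW L0)// subr_ge0 ltW.
suff h : K * \sum_(j < k) newest_component (Q j) (gradient f (x j)) <= f (x 0%N) - f (x k).
  by apply: le_trans h _; rewrite xE lerB.
elim: k => [|k IH]; first by rewrite big_ord0 mulr0 subrr.
rewrite big_ord_recr mulrDr/=.
have := quasi_newton_step_decrease m0 hb hc M10 M12 L0 df hL
  (fro2_subspace_mx f Q x k hP)
  (subspace_qn_run_sym_between k M12 hH0 hHd hrun) (step k).
rewrite -/K => hk.
have : K * newest_component (Q k) (gradient f (x k)) <= f (x k) - f (x k.+1).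
  by apply: le_trans hk; rewrite ler_wpM2l// newest_component_le.
by move: IH; lra.
Qed.

End Run.

(** * Measurability of matrix-valued maps *)

Section MatrixMeasurability.
Variable R : realType.
Context {disp : measure_display} {U : measurableType disp}.
Implicit Types (p q r : nat) (D : set U).

Definition mx_measurable p q D (X : U -> 'M[R]_(p, q)) : Prop :=
  forall i j, measurable_fun D (fun w => X w i j).

Lemma mx_measurable_cst p q D (A : 'M[R]_(p, q)) : mx_measurable D (fun _ => A).
Proof. by move=> i j; exact: measurable_cst. Qed.

Lemma mx_measurableS p q D D' (X : U -> 'M[R]_(p, q)) :
  measurable D' -> D `<=` D' -> mx_measurable D' X -> mx_measurable D X.
Proof. by move=> mD' DD' mX i j; apply: measurable_funS (mX i j). Qed.

Lemma eq_mx_measurable p q D (X Y : U -> 'M[R]_(p, q)) :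
  (forall w, D w -> X w = Y w) -> mx_measurable D X -> mx_measurable D Y.
Proof.
move=> XY mX i j; apply: eq_measurable_fun (mX i j) => w /set_mem Dw.
by rewrite XY.
Qed.

Lemma mx_measurableD p q D (X Y : U -> 'M[R]_(p, q)) :
  mx_measurable D X -> mx_measurable D Y -> mx_measurable D (fun w => X w + Y w).
Proof.
by move=> mX mY i j; under eq_fun do rewrite mxE; apply: measurable_funD.
Qed.

Lemma mx_measurableN p q D (X : U -> 'M[R]_(p, q)) :
  mx_measurable D X -> mx_measurable D (fun w => - X w).
Proof.
by move=> mX i j; under eq_fun do rewrite mxE; apply: measurable_funN.
Qed.

Lemma mx_measurableZ p q D (a : U -> R) (X : U -> 'M[R]_(p, q)) :
  measurable_fun D a -> mx_measurable D X ->
  mx_measurable D (fun w => a w *: X w).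
Proof.
by move=> ma mX i j; under eq_fun do rewrite mxE; apply: measurable_funM.
Qed.

Lemma mx_measurableM p q r D (X : U -> 'M[R]_(p, q)) (Y : U -> 'M[R]_(q, r)) :
  mx_measurable D X -> mx_measurable D Y ->
  mx_measurable D (fun w => X w *m Y w).
Proof.
move=> mX mY i j; under eq_fun do rewrite mxE.
by apply: measurable_sum => k; apply: measurable_funM.
Qed.

Lemma mx_measurable_tr p q D (X : U -> 'M[R]_(p, q)) :
  mx_measurable D X -> mx_measurable D (fun w => (X w)^T).
Proof. by move=> mX i j; under eq_fun do rewrite mxE; exact: mX. Qed.

Lemma measurable_dot p D (X Y : U -> 'cV[R]_p) :
  mx_measurable D X -> mx_measurable D Y ->
  measurable_fun D (fun w => dot (X w) (Y w)).
Proof. by move=> mX mY; apply/mx_measurableM => //; exact: mx_measurable_tr. Qed.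

Lemma measurable_enorm p D (X : U -> 'cV[R]_p) :
  mx_measurable D X -> measurable_fun D (fun w => enorm (X w)).
Proof.
move=> mX; apply: (measurableT_comp (f := @Num.sqrt R)).
  by apply: continuous_measurable_fun; exact: sqrt_continuous.
exact: measurable_dot.
Qed.

Lemma measurable_invr : measurable_fun [set: R] (@GRing.inv R).
Proof.
rewrite -(setUv [set 0]); apply/measurable_funU => //.
  exact: measurableC.
split; first exact: measurable_fun_set1.
apply: open_continuous_measurable_fun.
  by apply: closed_openC; apply: accessible_closed_set1; exact: hausdorff_accessible.
by move=> x /set_mem/= /eqP x0; exact: inv_continuous.
Qed.

Lemma mx_measurable_normalize p D (X : U -> 'cV[R]_p) :
  mx_measurable D X -> mx_measurable D (fun w => normalize (X w)).
Proof.
move=> mX; apply: mx_measurableZ => //.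
by apply: (measurableT_comp measurable_invr); exact: measurable_enorm.
Qed.

Lemma measurable_newest_component n d D (Q : U -> 'M[R]_(n, d)) (g : U -> 'cV[R]_n) :
  mx_measurable D Q -> mx_measurable D g ->
  measurable_fun D (fun w => newest_component (Q w) (g w)).
Proof.
move=> mQ mg; apply: measurable_funX; apply: measurable_dot => //.
apply: mx_measurable_normalize; apply: mx_measurableM => //.
by apply: mx_measurableM => //; exact: mx_measurable_tr.
Qed.

Lemma measurable_le_set D (f g : U -> R) : measurable D ->
  measurable_fun D f -> measurable_fun D g ->
  measurable (D `&` [set w | f w <= g w]).
Proof.
by move=> mD mf mg; exact: (@measurable_fun_ler _ _ _ _ _ _ mf mg mD [set true] I).
Qed.

(** Rational boxes form a countable base of the matrix topology, so the
    coordinatewise notion of measurability is the Borel one. *)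
Lemma mx_measurable_open p q D (X : U -> 'M[R]_(p, q)) (O : set 'M[R]_(p, q)) :
  measurable D -> mx_measurable D X -> open O -> measurable (D `&` X @^-1` O).
Proof.
move=> mD mX oO.
pose box (t : 'M[rat]_(p, q) * rat) : set 'M[R]_(p, q) :=
  [set A | forall i j, `|A i j - ratr (t.1 i j)| < ratr t.2].
pose F (t : 'M[rat]_(p, q) * rat) : set U :=
  if `[< box t `<=` O >] then D `&` X @^-1` box t else set0.
have -> : D `&` X @^-1` O = \bigcup_t F t.
  apply/seteqP; split => [w [Dw OXw]|w [t _]]; last first.
    by rewrite /F; case: asboolP => // tO [Dw Xw]; split => //; exact: tO.
  have /nbhs_ballP[e /= e0 eO] : nbhs (X w) O by exact: open_nbhs_nbhs.
  have [s] := rat_in_itvoo (divr_gt0 e0 (ltr0n R 2)).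
  rewrite in_itv/= => /andP[s0 se].
  have rP i j : exists r : rat, `|X w i j - ratr r| < ratr s.
    have [r] : exists r : rat, ratr r \in `]X w i j - ratr s, X w i j + ratr s[.
      by apply: rat_in_itvoo; rewrite ltrBlDr -addrA ltrDl addr_gt0.
    rewrite in_itv/= => /andP[r1 r2]; exists r.
    by rewrite ltr_norml; apply/andP; split; lra.
  exists (\matrix_(i, j) xchoose (rP i j), s) => //.
  rewrite /F asboolT.
    by split => // i j /=; rewrite mxE; exact: (xchooseP (rP i j)).
  move=> A bA; apply: eO; split => // i j.
  have := bA i j; rewrite /= mxE; have := xchooseP (rP i j).
  rewrite /ball/= !ltr_norml => /andP[h1 h2] /andP[h3 h4].
  by apply/andP; split; lra.
apply: countable_bigcupT_measurable; first exact: countableP.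
move=> t; rewrite /F; case: asboolP => // _.
have -> : D `&` X @^-1` box t =
    D `&` \bigcap_(ij in [set: 'I_p * 'I_q])
      (D `&` [set w | `|X w ij.1 ij.2 - ratr (t.1 ij.1 ij.2)| < ratr t.2]).
  apply/seteqP; split => w [Dw h]; split => //.
    by move=> [i j] _; split => //=; exact: h.
  by move=> i j; have [] := h (i, j) I.
apply: measurableI => //.
apply: fin_bigcap_measurable; first exact: finite_finset.
move=> [i j] _ /=.
have mf : measurable_fun D (fun w => `|X w i j - ratr (t.1 i j)|).
  apply: (measurableT_comp (f := fun y : R => `|y|)) => //.
  by apply: measurable_funB => //; exact: mX.
exact: (@measurable_fun_ltr _ _ _ _ _ _ mf
  (@measurable_cst _ _ U _ D (ratr t.2 : R)) mD [set true] I).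
Qed.

Lemma measurable_fun_continuous p q D (X : U -> 'M[R]_(p, q))
    (F : 'M[R]_(p, q) -> R) :
  measurable D -> mx_measurable D X -> continuous F ->
  measurable_fun D (fun w => F (X w)).
Proof.
move=> mD mX cF; apply: (measurability _ (RGenOpens.measurableE R)).
move=> _ [_ [a [b ->] <-]].
apply: (mx_measurable_open (O := F @^-1` `]a, b[%classic)) => //.
by apply: open_comp (interval_open _ _) => // y _; exact: cF.
Qed.

Lemma mx_measurable_continuous p q p' q' D (X : U -> 'M[R]_(p, q))
    (F : 'M[R]_(p, q) -> 'M[R]_(p', q')) :
  measurable D -> mx_measurable D X -> continuous F ->
  mx_measurable D (fun w => F (X w)).
Proof.
move=> mD mX cF i j.
apply: (measurable_fun_continuous (F := fun A => F A i j)) => // A.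
apply: (continuous_comp (f := F) (g := fun B : 'M[R]_(p', q') => B i j)); last exact: coord_continuous.
exact: cF.
Qed.

Lemma fro2_continuous p q (A : 'M[R]_(p, q)) :
  continuous (fun B : 'M[R]_(p, q) => fro2 (B - A)).
Proof.
rewrite /fro2; apply: continuous_big => [|i _]; first exact: add_continuous.
apply: continuous_big => [|j _]; first exact: add_continuous.
have cc : continuous (fun C : 'M[R]_(p, q) => (C - A) i j).
  move=> B; under eq_fun do rewrite !mxE.
  by apply: continuousB; [exact: coord_continuous|exact: cst_continuous].
by move=> B; exact: (continuousM (cc B) (cc B)).
Qed.

(** [Y] is a Lipschitz function of [X], defined on the values of [X] over [D].
    Its sublevel sets are preimages under [X] of unions of open balls centred at
    such values, hence measurable even if the set of values itself is not. *)
Lemma measurable_fun_lipschitz p q D (X : U -> 'M[R]_(p, q)) (Y : U -> R) :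
  measurable D -> mx_measurable D X ->
  (forall w w', D w -> D w' -> (Y w - Y w') ^+ 2 <= fro2 (X w - X w')) ->
  measurable_fun D Y.
Proof.
move=> mD mX hY; apply: (measurability _ (RGenInftyO.measurableE R)).
move=> _ [_ [t ->] <-].
(* The radius is what [Y] has left to grow before reaching [t]. *)
pose O : set 'M[R]_(p, q) :=
  \bigcup_(w in D `&` [set w | Y w < t])
    [set A | fro2 (A - X w) < (t - Y w) ^+ 2].
have oO : open O.
  apply: bigcup_open => w _.
  have -> : [set A | fro2 (A - X w) < (t - Y w) ^+ 2] =
      (fun A => fro2 (A - X w)) @^-1` `]-oo, (t - Y w) ^+ 2[.
    by apply/seteqP; split => A /=; rewrite in_itv.
  by apply: open_comp (interval_open _ _) => // A _; exact: fro2_continuous.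
have -> : D `&` Y @^-1` `]-oo, t[ = D `&` X @^-1` O.
  apply/seteqP; split => w [Dw]; rewrite /= ?in_itv/= => h; split => //.
    exists w; first by split.
    rewrite /= subrr /fro2 big1; first by rewrite exprn_gt0// subr_gt0.
    by move=> i _; rewrite big1// => j _; rewrite mxE expr0n.
  case: h => w' [Dw' /= Yt] /(le_lt_trans (hY _ _ Dw Dw')).
  rewrite -ltr_sqrt ?exprn_gt0 ?subr_gt0// !sqrtr_sqr.
  rewrite [X in _ < X]gtr0_norm ?subr_gt0//.
  by move=> /(le_lt_trans (ler_norm _)); lra.
exact: mx_measurable_open.
Qed.

End MatrixMeasurability.

(** * Eigenvalue clamping *)

Section Clamp.
Variable R : realType.
Implicit Types m : nat.

(** In the two eigenbases, [A - A'] has the entries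
    [(lam_i - lam'_j) W_ij] with [W = U^T V] orthogonal, and clamping does not
    increase [|lam_i - lam'_j|]. *)
Lemma fro2_eigen_clamp_le m (M1 M2 : R) (A A' B B' : 'M[R]_m) :
  M1 <= M2 -> eigen_clamp M1 M2 A B -> eigen_clamp M1 M2 A' B' ->
  fro2 (B - B') <= fro2 (A - A').
Proof.
move=> M12 [U [lam [UU -> ->]]] [V [lam' [VV -> ->]]].
have fro2E (C : 'M[R]_m) : fro2 C = \tr (C^T *m C).
  rewrite /fro2 exchange_big /mxtrace; apply: eq_bigr => j _.
  by rewrite mxE; apply: eq_bigr => i _; rewrite mxE expr2.
have UU' : U^T *m U = 1%:M by exact: mulmx1C.
have VV' : V^T *m V = 1%:M by exact: mulmx1C.
have fro2UV (C : 'M[R]_m) : fro2 (U^T *m C *m V) = fro2 C.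
  rewrite !fro2E !trmx_mul trmxK !mulmxA -(mulmxA (V^T *m C^T) U) UU mulmx1.
  by rewrite mxtrace_mulC !mulmxA VV mul1mx.
have ent (a b : 'rV[R]_m) i j :
    (U^T *m (U *m diag_mx a *m U^T - V *m diag_mx b *m V^T) *m V) i j =
    (a 0 i - b 0 j) * (U^T *m V) i j.
  have -> : U^T *m (U *m diag_mx a *m U^T - V *m diag_mx b *m V^T) *m V =
      diag_mx a *m (U^T *m V) - U^T *m V *m diag_mx b.
    rewrite mulmxBr mulmxBl !mulmxA UU' mul1mx.
    by rewrite -[U^T *m V *m diag_mx b *m V^T *m V]mulmxA VV' mulmx1.
  by rewrite mul_diag_mx mul_mx_diag !mxE; ring.
rewrite -fro2UV -[leRHS]fro2UV /fro2.
apply: ler_sum => i _; apply: ler_sum => j _; rewrite !ent !exprMn.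
apply: ler_wpM2r; first exact: sqr_ge0.
rewrite !mxE -[leRHS]real_normK ?num_real// -[leLHS]real_normK ?num_real// ler_sqr ?nnegrE//.
set x := lam 0 i; set y := lam' 0 j.
have clampP z : M2 < z /\ Num.max M1 (Num.min z M2) = M2 \/
    z < M1 /\ Num.max M1 (Num.min z M2) = M1 \/
    M1 <= z <= M2 /\ Num.max M1 (Num.min z M2) = z.
  have [h2|h2] := ltP M2 z; first by left; rewrite (max_r M12).
  have [h1|h1] := ltP z M1; right; first by left.
  by right.
have [xy|xy] := lerP x y; rewrite ler_norml; apply/andP.
  by case: (clampP x) => [[? ->]|[[? ->]|[/andP[? ?] ->]]];
    case: (clampP y) => [[? ->]|[[? ->]|[/andP[? ?] ->]]]; split; lra.
by case: (clampP x) => [[? ->]|[[? ->]|[/andP[? ?] ->]]];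
  case: (clampP y) => [[? ->]|[[? ->]|[/andP[? ?] ->]]]; split; lra.
Qed.

Lemma mx_measurable_eigen_clamp disp (U : measurableType disp) m (M1 M2 : R)
    (D : set U) (A B : U -> 'M[R]_m) :
  M1 <= M2 -> measurable D -> mx_measurable D A ->
  (forall w, D w -> eigen_clamp M1 M2 (A w) (B w)) -> mx_measurable D B.
Proof.
move=> M12 mD mA hB i j; apply: (measurable_fun_lipschitz mD mA) => w w' Dw Dw'.
apply: le_trans (fro2_eigen_clamp_le M12 (hB _ Dw) (hB _ Dw')).
rewrite /fro2 (bigD1 i)//= (bigD1 j)//= !mxE -addrA lerDl addr_ge0//.
  by rewrite sumr_ge0// => k _; rewrite sqr_ge0.
by rewrite sumr_ge0// => k _; rewrite sumr_ge0// => l _; rewrite sqr_ge0.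
Qed.

End Clamp.

(** * Measurability of the iterates *)

Section StepMeasurability.
Variable R : realType.
Context {disp : measure_display} {U : measurableType disp}.
Implicit Types (n m d : nat).

Lemma armijo_exponent_uniq m (beta c : R) (g : 'cV[R]_m -> R) dir i j :
  armijo_exponent beta c g dir i -> armijo_exponent beta c g dir j -> i = j.
Proof.
move=> [Ai Ni] [Aj Nj]; apply/eqP; rewrite eqn_leq; apply/andP; split.
  by rewrite leqNgt; apply/negP => /Ni; exact.
by rewrite leqNgt; apply/negP => /Nj; exact.
Qed.

Lemma measurable_armijo_exponent n m (beta c : R) (f : 'cV[R]_n -> R)
    (X : U -> 'cV[R]_n) (Pk : U -> 'M[R]_(n, m)) (dir : U -> 'cV[R]_m) i :
  classC2 f -> mx_measurable setT X -> mx_measurable setT Pk ->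
  mx_measurable setT dir ->
  measurable [set u | armijo_exponent beta c (fun v => f (X u + Pk u *m v))
                        (dir u) i].
Proof.
move=> [df dg _] mX mP mdir.
have cf : continuous f by move=> z; exact/differentiable_continuous/df.
have cg : continuous (gradient f).
  by move=> z; exact/differentiable_continuous/dg.
have mA a : measurable
    [set u | armijo c (fun v => f (X u + Pk u *m v)) (dir u) a].
  rewrite -[X in measurable X]setTI /armijo.
  under eq_set do rewrite gradient_affine// mulmx0 addr0.
  apply: measurable_le_set => //.
    apply: (measurable_fun_continuous (F := f)) => //.
    apply: mx_measurableD => //; apply: mx_measurableM => //.
    exact: mx_measurableZ.
  apply: measurable_funD; first exact: (measurable_fun_continuous (F := f)).
  apply: measurable_funM => //; apply: measurable_dot => //.
  apply: mx_measurableM; first exact: mx_measurable_tr.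
  exact: (mx_measurable_continuous (F := gradient f)).
rewrite (_ : mkset _ =
  [set u | armijo c (fun v => f (X u + Pk u *m v)) (dir u) (beta ^+ i)] `&`
  \bigcap_(j in [set j | (j < i)%N])
    ~` [set u | armijo c (fun v => f (X u + Pk u *m v)) (dir u) (beta ^+ j)]).
  apply: measurableI; first exact: mA.
  by apply: bigcap_measurableType => j _; apply/measurableC/mA.
by apply/seteqP; split => u [].
Qed.

(** On the event that the line search stops at [i], and according to whether
    [s^T y = 0], the new iterate is an explicit measurable expression. *)
Lemma measurable_quasi_newton_step n m (beta c M1 M2 : R) (f : 'cV[R]_n -> R)
    (X X' : U -> 'cV[R]_n) (Pk : U -> 'M[R]_(n, m)) (H Hdeg H' : U -> 'M[R]_m) :
  classC2 f -> M1 <= M2 ->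
  mx_measurable setT X -> mx_measurable setT Pk ->
  mx_measurable setT H -> mx_measurable setT Hdeg ->
  (forall u, quasi_newton_step beta c M1 M2 f (X u) (Pk u) (H u) (Hdeg u)
               (X' u) (H' u)) ->
  mx_measurable setT X' /\ mx_measurable setT H'.
Proof.
move=> hf M12 mX mP mH mHdeg step; have [df dg _] := hf.
have cg : continuous (gradient f).
  by move=> z; exact/differentiable_continuous/dg.
pose gr (s : U -> 'cV[R]_m) u :=
  gradient (fun v => f (X u + Pk u *m v)) (s u).
have mgr s : mx_measurable setT s -> mx_measurable setT (gr s).
  move=> ms; rewrite (_ : gr s = fun u => (Pk u)^T *m gradient f (X u + Pk u *m s u)).
    apply: mx_measurableM; first exact: mx_measurable_tr.
    apply: (mx_measurable_continuous (F := gradient f)) => //.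
    by apply: mx_measurableD => //; exact: mx_measurableM.
  by apply/funext => u; exact: gradient_affine.
pose dir u := - (H u *m gr (fun _ => 0) u).
have mdir : mx_measurable setT dir.
  apply: mx_measurableN; apply: mx_measurableM => //.
  by apply: mgr; exact: mx_measurable_cst.
pose E i := [set u | armijo_exponent beta c (fun v => f (X u + Pk u *m v))
                        (dir u) i].
have mE i : measurable (E i) by exact: measurable_armijo_exponent.
have ET : setT = \bigcup_i E i.
  by apply/seteqP; split => // u _; have [i Ei _] := step u; exists i.
have cover p q (Y : U -> 'M[R]_(p, q)) :
    (forall i, mx_measurable (E i) Y) -> mx_measurable setT Y.
  by move=> mY a b; rewrite ET; apply/measurable_fun_bigcup => // i; exact: mY.
have mS p q D (Y : U -> 'M[R]_(p, q)) : mx_measurable setT Y -> mx_measurable D Y.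
  by move=> mY; apply: mx_measurableS mY.
have stepE i u : E i u ->
    let s := beta ^+ i *: dir u in
    let y := gr (fun u => beta ^+ i *: dir u) u - gr (fun _ => 0) u in
    X' u = X u + beta ^+ i *: (Pk u *m dir u) /\
    (if dot s y == 0 then H' u = Hdeg u
     else eigen_clamp M1 M2 (bfgs_update (H u) s y) (H' u)).
  move=> Eiu; have [j Ej] := step u.
  by rewrite -(armijo_exponent_uniq Eiu Ej).
split; apply: cover => i.
  apply: (@eq_mx_measurable _ _ _ _ _ _ (fun u => X u + beta ^+ i *: (Pk u *m dir u))).
    by move=> u /stepE[-> _].
  apply: mS; apply: mx_measurableD => //; apply: mx_measurableZ => //.
  exact: mx_measurableM.
pose s u := beta ^+ i *: dir u.
pose y u := gr s u - gr (fun _ => 0) u.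
have ms : mx_measurable setT s by exact: mx_measurableZ.
have my : mx_measurable setT y.
  apply: mx_measurableD; first exact: mgr.
  by apply: mx_measurableN; apply: mgr; exact: mx_measurable_cst.
have mdsy : measurable_fun setT (fun u => dot (s u) (y u)).
  exact: measurable_dot.
pose Z := [set u | dot (s u) (y u) = 0].
have mZ : measurable Z.
  rewrite -[Z]setTI; exact: (mdsy measurableT [set 0] (measurable_set1 _)).
have -> : E i = (E i `&` Z) `|` (E i `&` ~` Z) by rewrite -setIUr setUv setIT.
suff [h1 h2] : mx_measurable (E i `&` Z) H' /\ mx_measurable (E i `&` ~` Z) H'.
  move=> a b; apply/measurable_funU; last by split; [exact: h1|exact: h2].
    exact: measurableI.
  by apply: measurableI => //; exact: measurableC.
split.
  apply: eq_mx_measurable (mS _ _ _ _ mHdeg).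
  by move=> u [/stepE[_]] + Zu; rewrite -/(s u) -/(y u) Zu eqxx.
apply: (@mx_measurable_eigen_clamp _ _ _ _ M1 M2 _
    (fun u => bfgs_update (H u) (s u) (y u))) => //.
- by apply: measurableI => //; exact: measurableC.
- apply: mS; rewrite /bfgs_update.
  have mr : measurable_fun setT (fun u => (dot (s u) (y u))^-1).
    exact: (measurableT_comp (@measurable_invr R) mdsy).
  have m1 : mx_measurable setT (fun _ : U => 1%:M : 'M[R]_m).
    exact: mx_measurable_cst.
  have msT := mx_measurable_tr ms; have myT := mx_measurable_tr my.
  apply: mx_measurableD.
    apply: mx_measurableM; first apply: mx_measurableM => //.
      apply: mx_measurableD => //; apply: mx_measurableN.
      by apply: mx_measurableZ => //; exact: mx_measurableM.
    apply: mx_measurableD => //; apply: mx_measurableN.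
    by apply: mx_measurableZ => //; exact: mx_measurableM.
  by apply: mx_measurableZ => //; exact: mx_measurableM.
- by move=> u [/stepE[_]] + /= /eqP/negbTE Zu; rewrite -/(s u) -/(y u) Zu.
Qed.

Lemma measurable_subspace_mx n d m (f : 'cV[R]_n -> R) (Pinit : 'M[R]_(n, m))
    (Q : nat -> U -> 'M[R]_(n, d)) (x : nat -> U -> 'cV[R]_n) k :
  classC2 f ->
  (forall l, (l <= k)%N -> mx_measurable setT (Q l)) ->
  (forall l, (l <= k)%N -> mx_measurable setT (x l)) ->
  mx_measurable setT (fun u => subspace_mx f Pinit (Q ^~ u) (x ^~ u) k).
Proof.
move=> [_ dg _] mQ mx a b; under eq_fun do rewrite mxE /subspace_col.
case: insubP => [j _ _|_]; first by exact: measurable_cst.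
set t := (k.+1.*2 + b - m)%N.
have tk : (t./2 <= k)%N.
  by have := ltn_ord b; rewrite /t; lia.
have mg : mx_measurable setT (fun u => gradient f (x t./2 u)).
  apply: (mx_measurable_continuous (F := gradient f)) => //; first exact: mx.
  by move=> z; exact/differentiable_continuous/dg.
case: (odd t); last exact: (mx_measurable_normalize (mx _ tk)).
apply: mx_measurable_normalize; apply: mx_measurableM => //.
by apply: mx_measurableM; [|apply: mx_measurable_tr]; exact: mQ.
Qed.

End StepMeasurability.

(** The map [pi] is in use the identity of [T], from [T] with a smaller
    sigma-algebra: it lets the sample space carry any sigma-algebra for which
    the matrices [Q_l] with [l < k] are measurable. *)
Section RunMeasurability.
Context (R : realType) (disp : measure_display) (T : measurableType disp)
  (P : probability T R) (n d m : nat).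
Variable Q : nat -> 'I_n -> 'I_d -> {RV P >-> R}.

Lemma history_preimage disp' (U : measurableType disp') (pi : U -> T) k A :
  (forall l i j, (l <= k)%N -> measurable_fun setT (Q l i j \o pi)) ->
  history Q k A -> measurable (pi @^-1` A).
Proof.
move=> mQ; move: A; apply: smallest_sub.
  split => [|A mA|F mF].
  - by rewrite preimage_set0.
  - by rewrite setTD preimage_setC; exact: measurableC.
  - by rewrite preimage_bigcup; apply: bigcupT_measurable.
move=> _ [l [i [j [B [lk mB ->]]]]].
by rewrite -[X in measurable X]setTI; exact: mQ.
Qed.

Lemma mx_measurable_run disp' (U : measurableType disp') (pi : U -> T)
    (beta c M1 M2 : R) (f : 'cV[R]_n -> R) x0 H0 (Pinit : 'M[R]_(n, m))
    (Hdeg : nat -> T -> 'M[R]_m) (x : nat -> T -> 'cV[R]_n)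
    (H : nat -> T -> 'M[R]_m) k :
  classC2 f -> M1 <= M2 ->
  (forall k, history_measurable Q k (Hdeg k)) ->
  (forall w, subspace_qn_run beta c M1 M2 f x0 H0 Pinit
     (fun k => random_mx (Q k) w) (fun k => Hdeg k w)
     (fun k => x k w) (fun k => H k w)) ->
  (forall l i j, (l < k)%N -> measurable_fun setT (Q l i j \o pi)) ->
  forall l, (l <= k)%N ->
  mx_measurable setT (x l \o pi) /\ mx_measurable setT (H l \o pi).
Proof.
move=> hf M12 hHd hrun; elim: k => [_ l|k IH mQ l].
  rewrite leqn0 => /eqP ->; split.
    apply: (@eq_mx_measurable _ _ _ _ _ _ (fun _ => x0)) => [u _ /=|].
      by have [-> _ _] := hrun (pi u).
    exact: mx_measurable_cst.
  apply: (@eq_mx_measurable _ _ _ _ _ _ (fun _ => H0)) => [u _ /=|].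
    by have [_ -> _] := hrun (pi u).
  exact: mx_measurable_cst.
have {}IH := IH (fun l i j lk => mQ l i j (ltnW lk)).
rewrite leq_eqVlt => /predU1P[->|]; last exact: IH.
apply: (@measurable_quasi_newton_step _ _ _ _ _ beta c M1 M2 f (x k \o pi) _
  (fun u => subspace_mx f Pinit (fun l => random_mx (Q l) (pi u))
    (fun l => x l (pi u)) k) (H k \o pi) (Hdeg k \o pi)) => //.
- by have [] := IH k (leqnn k).
- apply: (@measurable_subspace_mx _ _ _ _ _ _ _ _
    (fun l u => random_mx (Q l) (pi u)) (fun l u => x l (pi u))) => //.
    by move=> l' lk i j; under eq_fun do rewrite mxE; exact: mQ.
  by move=> l' lk; have [] := IH l' lk.
- by have [] := IH k (leqnn k).
- move=> a b _ B mB; rewrite setTI.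
  exact: (history_preimage mQ (hHd k a b B mB)).
- by move=> u; have [_ _] := hrun (pi u); exact.
Qed.

End RunMeasurability.

(** * Independence and freezing *)

Section Independence.
Context (R : realType) (disp : measure_display) (T : measurableType disp)
  (P : probability T R).
Local Open Scope ereal_scope.

(** Both sides are finite measures in [A] that agree on the pi-system [G]. *)
Lemma indep_sigma_algebra (G : set (set T)) (B : set T) :
  setI_closed G -> G setT -> G `<=` measurable -> measurable B ->
  (forall A, G A -> P (A `&` B) = P A * P B) ->
  forall A, <<s G >> A -> P (A `&` B) = P A * P B.
Proof.
move=> GI GT Gm mB GP A sA.
have PB0 : (0 <= fine (P B))%R by rewrite fine_ge0.
have PBE : P B = (fine (P B))%:E by rewrite fineK ?fin_num_measure.
have coverT : \bigcup_(k : nat) [set: T] = setT by exact: bigcup_const.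
have := @g_sigma_algebra_measure_unique _ _ _ G Gm (fun _ => setT) (fun _ => GT) coverT
  (mrestr P mB) (mscale (NngNum PB0) P).
rewrite /mrestr/= /mscale/= -PBE => uniq.
rewrite muleC; apply: uniq sA => //.
  by move=> C GC; rewrite [LHS]GP// muleC.
by move=> _; rewrite /mrestr setTI ltey_eq fin_num_measure.
Qed.

Context (I : eqType) (X : I -> {RV P >-> R}).

Definition cylinders (D : pred I) : set (set T) :=
  [set A | exists (J : seq I) (B : I -> set R),
     [/\ uniq J, {subset J <= D}, forall i, measurable (B i)
       & A = \bigcap_(i in [set` J]) (X i @^-1` B i)]].

Lemma cylindersT D : cylinders D setT.
Proof.
exists [::], (fun _ => setT); split => //.
by apply/seteqP; split => // w _ i.
Qed.

Lemma cylinders_preimage (D : pred I) i (B : set R) :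
  D i -> measurable B -> cylinders D (X i @^-1` B).
Proof.
move=> Di mB; exists [:: i], (fun _ => B); split => //.
  by move=> j; rewrite inE => /eqP ->.
apply/seteqP; split => [w Bw j|w]; first by rewrite /= inE => /eqP ->.
by apply; rewrite /= inE.
Qed.

Lemma cylindersI D : setI_closed (cylinders D).
Proof.
move=> _ _ [J [B [uJ JD mB ->]]] [K [C [uK KD mC ->]]].
exists (undup (J ++ K)), (fun i => (if i \in J then B i else setT) `&`
  (if i \in K then C i else setT)); split.
- exact: undup_uniq.
- by move=> i; rewrite mem_undup mem_cat => /orP[/JD|/KD].
- by move=> i; apply: measurableI; case: ifP.
- apply/seteqP; split => [w [h1 h2] i _ /=|w h].
    by split; case: ifPn => //; [exact: h1|exact: h2].
  split => i /= iJ.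
    by have [] := h i; rewrite /= ?mem_undup ?mem_cat iJ.
  by have [] := h i; rewrite /= ?mem_undup ?mem_cat iJ ?orbT.
Qed.

Lemma measurable_cylinders D : cylinders D `<=` measurable.
Proof.
move=> _ [J [B [_ _ mB ->]]].
apply: fin_bigcap_measurable; first exact: finite_seq.
by move=> i _; rewrite -[X in measurable X]setTI; exact: measurable_funPT.
Qed.

(** Cylinders over disjoint index sets factor by mutual independence, and form
    pi-systems; the extension to the generated sigma-algebras is made on one
    side at a time. *)
Lemma indep_cylinders (D1 D2 : pred I) : mutually_independent X ->
  (forall i, ~~ (D1 i && D2 i)) ->
  forall A B, <<s cylinders D1 >> A -> <<s cylinders D2 >> B ->
  P (A `&` B) = P A * P B.
Proof.
move=> indep disj A B sA sB.
have sm D E : <<s cylinders D >> E -> measurable E.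
  exact: (smallest_sub (@sigma_algebra_measurable _ T) (@measurable_cylinders D)).
apply: (indep_sigma_algebra (G := cylinders D1)) sA.
- exact: cylindersI.
- exact: cylindersT.
- exact: measurable_cylinders.
- exact: sm sB.
move=> {}A cA; rewrite setIC muleC.
apply: (indep_sigma_algebra (G := cylinders D2)) sB.
- exact: cylindersI.
- exact: cylindersT.
- exact: measurable_cylinders.
- exact: measurable_cylinders cA.
case: cA => [J [C [uJ JD mC ->]]] _ [K [E [uK KD mE ->]]].
have KJ i : i \in K -> (i \in J) = false.
  move=> /KD D2i; apply/negP => /JD D1i.
  by have := disj i; rewrite -[D1 i]/(i \in D1) D1i -[D2 i]/(i \in D2) D2i.
pose F i := if i \in J then C i else E i.
have mF i : measurable (F i) by rewrite /F; case: ifP.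
have uKJ : uniq (K ++ J).
  rewrite cat_uniq uK uJ andbT/=; apply/hasPn => i iJ.
  by apply/negP => /KJ; rewrite iJ.
have -> : \bigcap_(i in [set` K]) X i @^-1` E i `&`
          \bigcap_(i in [set` J]) X i @^-1` C i =
          \bigcap_(i in [set` K ++ J]) X i @^-1` F i.
  apply/seteqP; split => [w [h1 h2] i|w h].
    rewrite /= mem_cat => /orP[iK|iJ]; rewrite /F.
      by rewrite KJ//; exact: h1.
    by rewrite iJ; exact: h2.
  split => i /= iK; have := h i; rewrite /= mem_cat iK ?orbT /F.
    by rewrite KJ//; exact.
  by rewrite iK; exact.
rewrite !indep// big_cat/=; congr (_ * _).
  by apply: eq_big_seq => i iK; rewrite /F KJ.
by apply: eq_big_seq => i iJ; rewrite /F iJ.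
Qed.

(** Independence says that the image of [P] under the diagonal map
    [T -> T * T] is a product measure, the two factors carrying the two
    sigma-algebras; Tonelli's theorem then integrates out the second
    variable with the first one frozen. *)
Lemma freezing (G1 G2 : set (set T))
    (phi : g_sigma_algebraType G1 * g_sigma_algebraType G2 -> \bar R)
    (psi : T -> \bar R) :
  G1 `<=` measurable -> G2 `<=` measurable ->
  (forall A B, <<s G1 >> A -> <<s G2 >> B -> P (A `&` B) = P A * P B) ->
  measurable_fun setT phi -> (forall w, 0 <= phi w) ->
  measurable_fun (setT : set (g_sigma_algebraType G1)) psi ->
  (forall w, 0 <= psi w) ->
  (forall w1, psi w1 <= \int[P]_w2 phi (w1, w2)) ->
  \int[P]_w psi w <= \int[P]_w phi (w, w).
Proof.
move=> mG1 mG2 indep mphi phi0 mpsi psi0 hpsi.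
pose U1 : measurableType _ := g_sigma_algebraType G1.
pose U2 : measurableType _ := g_sigma_algebraType G2.
have sm (G : set (set T)) (E : set T) : G `<=` measurable -> <<s G >> E -> measurable E.
  by move=> mG; exact: (smallest_sub (@sigma_algebra_measurable _ T) mG).
pose id1 : T -> U1 := id. pose id2 : T -> U2 := id.
have m1 : measurable_fun setT id1.
  by move=> _ A mA; rewrite setTI; exact: sm mA.
have m2 : measurable_fun setT id2.
  by move=> _ A mA; rewrite setTI; exact: sm mA.
pose D1 : {RV P >-> U1} := HB.pack id1 (isMeasurableFun.Build _ _ _ _ id1 m1).
pose D2 : {RV P >-> U2} := HB.pack id2 (isMeasurableFun.Build _ _ _ _ id2 m2).
pose diag (w : T) : U1 * U2 := (w, w).
have mdiag : measurable_fun setT diag by exact: measurable_fun_pair.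
pose DD : {RV P >-> (U1 * U2)%type} :=
  HB.pack diag (isMeasurableFun.Build _ _ _ _ diag mdiag).
have prodE S : measurable S ->
    (distribution P D1 \x distribution P D2) S = distribution P DD S.
  apply: product_measure_unique => A B mA mB.
  exact: indep.
have -> : \int[P]_w phi (w, w) = \int[distribution P DD]_z phi z.
  by rewrite ge0_integral_distribution.
rewrite (eq_measure_integral (distribution P D1 \x distribution P D2)); last first.
  by move=> S mS _; rewrite [RHS]prodE.
rewrite fubini_tonelli1//.
have -> : \int[P]_w psi w = \int[distribution P D1]_w psi w.
  by rewrite ge0_integral_distribution.
apply: ge0_le_integral => //.
- exact: measurable_fun_fubini_tonelli_F.
move=> w _; apply: le_trans (hpsi w) _.
rewrite /fubini_F ge0_integral_distribution//.
exact: measurable_fun_pair2.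
Qed.

End Independence.

(** * Lower bounds on the newest component *)

Section NewestComponent.
Variable R : realType.
Implicit Types n d : nat.

Lemma newest_componentE n d (Q : 'M[R]_(n, d)) (v : 'cV[R]_n) :
  newest_component Q v =
  dot (Q^T *m v) (Q^T *m v) ^+ 2 /
  dot (Q *m Q^T *m v) (Q *m Q^T *m v).
Proof.
rewrite /newest_component /normalize dotZl exprMn exprVn enorm_sqr mulrC.
by congr (_ ^+ 2 / _); rewrite dotC -mulmxA dot_mulmx.
Qed.

Lemma newest_component_ge0 n d (Q : 'M[R]_(n, d)) (v : 'cV[R]_n) :
  0 <= newest_component Q v.
Proof. exact: sqr_ge0. Qed.

Lemma newest_component_lower n d (Q : 'M[R]_(n, d)) (v : 'cV[R]_n) t :
  0 < dot (Q^T *m v) (Q^T *m v) ->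
  t * dot (Q *m Q^T *m v) (Q *m Q^T *m v) <= dot (Q^T *m v) (Q^T *m v) ^+ 2 ->
  t <= newest_component Q v.
Proof.
move=> a0; rewrite newest_componentE; set S := Q *m Q^T *m v => h.
have S0 : 0 < dot S S.
  rewrite lt_def dot_ge0 andbT; apply/eqP => S0.
  have := cauchy_schwarz_dot S v; rewrite S0 mul0r.
  have -> : dot S v = dot (Q^T *m v) (Q^T *m v).
    by rewrite dotC /S -mulmxA dot_mulmx.
  by rewrite leNgt exprn_gt0.
by rewrite ler_pdivlMr.
Qed.

(** The first bound gives [|Q^T v|^2 >= (1 - eps) d |v|^2] and the second one
    [|Q Q^T v| <= C n |v|]. *)
Lemma newest_component_concentration n d (Q : 'M[R]_(n, d)) (v : 'cV[R]_n) (C eps : R) :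
  (0 < d)%N -> (0 < n)%N -> 0 < C -> 0 < eps < 1 ->
  (1 - eps) * enorm v ^+ 2 <= enorm ((Num.sqrt d%:R)^-1 *: (Q^T *m v)) ^+ 2 ->
  d%:R^-1 * opnorm (Q *m Q^T) <= C * (n%:R / d%:R) ->
  ((1 - eps) * d%:R / (C * n%:R)) ^+ 2 * dot v v <= newest_component Q v.
Proof.
move=> d0 n0 C0 /andP[e0 e1] hv hop.
have dR : 0 < d%:R :> R by rewrite ltr0n.
have nR : 0 < n%:R :> R by rewrite ltr0n.
have [v0|vN0] := eqVneq (dot v v) 0; first by rewrite v0 mulr0 newest_component_ge0.
have vp : 0 < dot v v by rewrite lt_def vN0 dot_ge0.
set a := dot (Q^T *m v) (Q^T *m v).
have ha : (1 - eps) * d%:R * dot v v <= a.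
  move: hv; rewrite !enorm_sqr dotZl dotZr mulrA -expr2 exprVn sqr_sqrtr ?ler0n//.
  by rewrite ler_pdivlMl// => h; apply: le_trans h; rewrite mulrA (mulrC d%:R).
have ap : 0 < a by apply: lt_le_trans ha; rewrite !mulr_gt0// subr_gt0.
have hop' : opnorm (Q *m Q^T) <= C * n%:R.
  have E : C * (n%:R / d%:R) = d%:R^-1 * (C * n%:R) by ring.
  by move: hop; rewrite E ler_pM2l ?invr_gt0.
have hS : dot (Q *m Q^T *m v) (Q *m Q^T *m v) <= (C * n%:R) ^+ 2 * dot v v.
  rewrite -!enorm_sqr -exprMn ler_sqr ?nnegrE ?enorm_ge0//; last first.
    by rewrite !mulr_ge0 ?enorm_ge0// ltW.
  apply: le_trans (enorm_mulmx_opnorm _ _) _.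
  by rewrite ler_wpM2r ?enorm_ge0.
apply: newest_component_lower => //.
apply: (@le_trans _ _ (((1 - eps) * d%:R * dot v v) ^+ 2)); last first.
  rewrite ler_sqr ?nnegrE ?(ltW ap)//.
  by rewrite !mulr_ge0 ?ler0n ?dot_ge0// subr_ge0 ltW.
apply: le_trans (ler_wpM2l _ hS) _.
  by rewrite mulr_ge0 ?sqr_ge0 ?dot_ge0.
rewrite le_eqVlt; apply/orP; left; apply/eqP.
by field; rewrite !gt_eqF.
Qed.

(** If the signs of the rows of [Q] agree with those of [v] then no
    cancellation takes place in [Q^T v]. *)
Lemma newest_component_sign_event n d (Q : 'M[R]_(n, d)) (v : 'cV[R]_n) :
  (0 < d)%N -> (0 < n)%N ->
  (forall i j, 1 <= (if 0 <= v i 0 then Q i j else - Q i j) <= 2) ->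
  (4 * n%:R)^-1 * dot v v <= newest_component Q v.
Proof.
move=> d0 n0 hQ.
have dR : 0 < d%:R :> R by rewrite ltr0n.
have nR : 0 < n%:R :> R by rewrite ltr0n.
have [v0|vN0] := eqVneq (dot v v) 0; first by rewrite v0 mulr0 newest_component_ge0.
have vp : 0 < dot v v by rewrite lt_def vN0 dot_ge0.
set a := dot (Q^T *m v) (Q^T *m v).
have ha : d%:R * dot v v <= a.
  rewrite /a [leRHS]dotE -[d in leLHS](card_ord d) -sum1_card natr_sum mulr_suml.
  apply: ler_sum => j _; rewrite mul1r -expr2.
  have h : \sum_i `|v i 0| <= (Q^T *m v) j 0.
    rewrite mxE; apply: ler_sum => i _; rewrite mxE.
    have := hQ i j; case: (lerP 0 (v i 0)) => vi /andP[h _].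
      by rewrite ger0_norm// ler_peMl.
    by rewrite ltr0_norm// -mulrNN ler_peMl// oppr_ge0 ltW.
  have s0 : 0 <= \sum_i `|v i 0| by apply: sumr_ge0.
  apply: (@le_trans _ _ ((\sum_i `|v i 0|) ^+ 2)); last first.
    by rewrite ler_sqr ?nnegrE// (le_trans s0).
  rewrite dotE expr2 mulr_suml; apply: ler_sum => i _.
  rewrite -expr2 -real_normK ?num_real// expr2 ler_wpM2l//.
  by rewrite (bigD1 i)//= lerDl sumr_ge0.
have ap : 0 < a by apply: lt_le_trans ha; rewrite mulr_gt0.
have hS : dot (Q *m Q^T *m v) (Q *m Q^T *m v) <= 4 * n%:R * d%:R * a.
  rewrite -mulmxA; apply: le_trans (dot_mulmx_fro2 _ _) _.
  rewrite ler_wpM2r ?dot_ge0// /fro2.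
  have -> : 4 * n%:R * d%:R = \sum_(i < n) \sum_(j < d) (4 : R).
    by rewrite !sumr_const !card_ord -mulrnA -[RHS]mulr_natr natrM; ring.
  apply: ler_sum => i _; apply: ler_sum => j _.
  have -> : Q i j ^+ 2 = (if 0 <= v i 0 then Q i j else - Q i j) ^+ 2.
    by case: ifP; rewrite ?sqrrN.
  have := hQ i j; set q := if _ then _ else _ => /andP[h1 h2]; nra.
apply: newest_component_lower => //.
apply: le_trans (ler_wpM2l _ hS) _.
  by rewrite mulr_ge0 ?dot_ge0// invr_ge0 mulr_ge0 ?ltW.
have -> : (4 * n%:R)^-1 * dot v v * (4 * n%:R * d%:R * a) = d%:R * dot v v * a.
  by field; rewrite gt_eqF.
by rewrite expr2 ler_wpM2r ?(ltW ap).
Qed.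

End NewestComponent.

Section NewestComponentExpectation.
Context (R : realType) (disp : measure_display) (T : measurableType disp)
  (P : probability T R).

Lemma integral_ge_event (Z : T -> R) (E : set T) (t p : R) :
  measurable_fun setT Z -> (forall w, 0 <= Z w) -> 0 <= t ->
  measurable E -> (p%:E <= P E)%E -> (forall w, E w -> t <= Z w) ->
  ((t * p)%:E <= \int[P]_w (Z w)%:E)%E.
Proof.
move=> mZ Z0 t0 mE pE tZ.
apply: (@le_trans _ _ (\int[P]_(w in E) (t%:E))%E).
  rewrite integral_cst//= EFinM; apply: lee_wpmul2l => //.
apply: (@le_trans _ _ (\int[P]_(w in E) (Z w)%:E)%E).
  apply: ge0_le_integral => //.
  apply/measurable_EFinP; exact: measurable_funTS.
apply: ge0_subset_integral => //.
  exact/measurable_EFinP.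
by move=> w _; rewrite lee_fin.
Qed.

Lemma probability_setI_ge (A B : set T) (a b : R) :
  measurable A -> measurable B -> ((1 - a)%:E <= P A)%E ->
  ((1 - b)%:E <= P B)%E -> ((1 - (a + b))%:E <= P (A `&` B))%E.
Proof.
move=> mA mB.
have fin E : measurable E -> P E = (fine (P E))%:E.
  by move=> mE; rewrite fineK ?fin_num_measure.
have mAB : measurable (A `&` B) by exact: measurableI.
have mU : measurable (A `|` B) by exact: measurableU.
have U1 := probability_le1 P mU.
have hA : (P A < +oo)%E by rewrite ltey_eq fin_num_measure.
have hU : (P (A `|` B) = P A + P B - P (A `&` B))%E := measureUfinl mA mB hA.
move: U1 hU; rewrite (fin _ mA) (fin _ mB) (fin _ mAB) (fin _ mU).
rewrite -EFinN -!EFinD !lee_fin => U1 [h] h1 h2; lra.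
Qed.

Variables (n d : nat) (X : 'I_n -> 'I_d -> {RV P >-> R}).

Lemma mx_measurable_random_mx : mx_measurable setT (random_mx X).
Proof.
by move=> i j; under eq_fun do rewrite mxE; exact: measurable_funPT.
Qed.

Lemma expectation_newest_component_concentration (C0 C eps : R) (v : 'cV[R]_n) :
  (0 < d)%N -> (0 < n)%N -> 0 < C -> 0 < eps < 1 ->
  norm_preservation_const n d C0 -> opnorm_bound_const n d C ->
  gaussian_mx X ->
  ((((1 - eps) * d%:R / (C * n%:R)) ^+ 2 * prob_level d C0 eps * dot v v)%:E
   <= \int[P]_w (newest_component (random_mx X w) v)%:E)%E.
Proof.
move=> d0 n0 Cp heps hC0 hC hX.
have mX := mx_measurable_random_mx.
have mXt := mx_measurable_tr mX.
rewrite mulrAC /prob_level.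
set E1 := [set w | (1 - eps) * enorm v ^+ 2 <=
  enorm ((Num.sqrt d%:R)^-1 *: ((random_mx X w)^T *m v)) ^+ 2 <=
  (1 + eps) * enorm v ^+ 2].
set E2 := [set w | d%:R^-1 * opnorm (random_mx X w *m (random_mx X w)^T) <=
  C * (n%:R / d%:R)].
have mE1 : measurable E1.
  have mf : measurable_fun setT (fun w =>
      enorm ((Num.sqrt d%:R)^-1 *: ((random_mx X w)^T *m v)) ^+ 2).
    apply: measurable_funX; apply: measurable_enorm; apply: mx_measurableZ => //.
    by apply: mx_measurableM => //; exact: mx_measurable_cst.
  have -> : E1 =
     (setT `&` [set w | (1 - eps) * enorm v ^+ 2 <=
       enorm ((Num.sqrt d%:R)^-1 *: ((random_mx X w)^T *m v)) ^+ 2]) `&`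
     (setT `&` [set w | enorm ((Num.sqrt d%:R)^-1 *: ((random_mx X w)^T *m v)) ^+ 2
       <= (1 + eps) * enorm v ^+ 2]).
    by rewrite !setTI; apply/seteqP; split => w /= => [/andP//|h]; apply/andP.
  by apply: measurableI; apply: measurable_le_set.
have mE2 : measurable E2.
  have dR : 0 < d%:R :> R by rewrite ltr0n.
  pose t := C * n%:R.
  have t0 : 0 <= t by rewrite mulr_ge0// ltW.
  (* A bound on the operator norm is a closed condition on the matrix. *)
  pose K : set 'M[R]_n := \bigcap_(u in [set u : 'cV[R]_n | enorm u <= 1])
    [set M | dot (M *m u) (M *m u) <= t ^+ 2].
  have cK : closed K.
    apply: closed_bigI => u _.
    have dotME (M : 'M[R]_n) : dot (M *m u) (M *m u) =
        \sum_i (\sum_j M i j * u j 0) * (\sum_j M i j * u j 0).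
      by rewrite dotE; apply: eq_bigr => i _; rewrite !mxE.
    have -> : [set M : 'M[R]_n | dot (M *m u) (M *m u) <= t ^+ 2] =
        (fun M : 'M[R]_n => \sum_i (\sum_j M i j * u j 0) * (\sum_j M i j * u j 0))
          @^-1` [set y | y <= t ^+ 2].
      by apply/seteqP; split => M /=; rewrite dotME.
    apply: preimage_closed; last exact: closed_le.
    move=> M _; move: M. apply: continuous_big => [|i _]; first exact: add_continuous.
    have cs : continuous (fun M : 'M[R]_n => \sum_j M i j * u j 0).
      apply: continuous_big => [|j _]; first exact: add_continuous.
      move=> M; apply: continuousM; first exact: coord_continuous.
      exact: cst_continuous.
    by move=> M; exact: (continuousM (cs M) (cs M)).
  have -> : E2 = ~` (setT `&` (fun w => random_mx X w *m (random_mx X w)^T) @^-1` ~` K).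
    rewrite setTI preimage_setC setCK; apply/seteqP; split => w; rewrite /E2 /K/=.
      have -> : C * (n%:R / d%:R) = d%:R^-1 * t by rewrite /t; ring.
      rewrite ler_pM2l ?invr_gt0// => /opnorm_leP h u u1 /=.
      by rewrite -enorm_sqr ler_sqr ?nnegrE ?enorm_ge0//; exact: h.
    move=> h; have -> : C * (n%:R / d%:R) = d%:R^-1 * t by rewrite /t; ring.
    rewrite ler_pM2l ?invr_gt0//; apply/opnorm_leP => u u1.
    by have := h u u1; rewrite /= -enorm_sqr ler_sqr ?nnegrE ?enorm_ge0.
  apply: measurableC; apply: mx_measurable_open => //.
    exact: mx_measurableM.
  exact: closed_openC.
apply: (integral_ge_event (E := E1 `&` E2)).
- by apply: measurable_newest_component => //; exact: mx_measurable_cst.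
- by move=> w; exact: newest_component_ge0.
- by rewrite mulr_ge0 ?sqr_ge0 ?dot_ge0.
- exact: measurableI.
- by apply: probability_setI_ge => //; [exact: hC0|exact: hC].
- by move=> w [/andP[h _] h2]; exact: newest_component_concentration.
Qed.

(** On [[-2, 2]] the standard normal density is at least its value at [2]. *)
Lemma normal_prob_unit_itv_ge (a b : R) : -2 <= a -> b <= 2 -> b - a = 1 ->
  ((normal_peak 1 * expR (- 2))%:E <= normal_prob 0 1 `[a, b])%E.
Proof.
move=> a2 b2 ab.
have -> : ((normal_peak 1 * expR (- 2))%:E =
    \int[lebesgue_measure]_(x in `[a, b]) (normal_peak 1 * expR (- 2))%:E)%E.
  rewrite integral_cst//= lebesgue_measure_itv/= lte_fin.
  by rewrite (_ : a < b) -?EFinB ?ab ?mule1// -subr_gt0 ab.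
apply: ge0_le_integral => //.
- by move=> x _; rewrite lee_fin mulr_ge0 ?normal_peak_ge0 ?expR_ge0.
- apply/measurable_EFinP; apply: measurable_funTS; exact: measurable_normal_pdf.
move=> x /=; rewrite in_itv/= => /andP[ax xb].
rewrite lee_fin normal_pdfE ?oner_eq0//.
rewrite ler_wpM2l ?normal_peak_ge0// /normal_fun ler_expR subr0 expr1n.
rewrite mulNr lerN2 ler_pdivrMr//; nra.
Qed.

(** The entries of [Q] being independent, the sign event of [v] has probability
    at least [p0 ^ (n d)], with [p0] a lower bound for the normal probability of
    both [[1, 2]] and [[-2, -1]]; this does not depend on [v]. *)
Lemma expectation_newest_component_sign (v : 'cV[R]_n) :
  (0 < d)%N -> (0 < n)%N -> gaussian_mx X ->
  (((4 * n%:R)^-1 * (normal_peak 1 * expR (- 2)) ^+ (n * d) * dot v v)%:E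
   <= \int[P]_w (newest_component (random_mx X w) v)%:E)%E.
Proof.
move=> d0 n0 [normX indep].
have mX := mx_measurable_random_mx.
pose B (ij : 'I_n * 'I_d) : set R :=
  if 0 <= v ij.1 0 then `[1, 2]%classic else `[-2, -1]%classic.
have mB ij : measurable (B ij) by rewrite /B; case: ifP => _; exact: measurable_itv.
pose E := \bigcap_(ij in [set` index_enum ('I_n * 'I_d)%type]) (X ij.1 ij.2 @^-1` B ij).
have mXB ij : measurable (X ij.1 ij.2 @^-1` B ij).
  by rewrite -[X in measurable X]setTI; exact: measurable_funPT.
rewrite mulrAC; apply: (integral_ge_event (E := E)).
- by apply: measurable_newest_component => //; exact: mx_measurable_cst.
- by move=> w; exact: newest_component_ge0.
- by rewrite mulr_ge0 ?dot_ge0// invr_ge0 mulr_ge0.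
- by apply: fin_bigcap_measurable => //; exact: finite_seq.
- rewrite indep ?index_enum_uniq//.
  set p0 := normal_peak 1 * _.
  have p00 : 0 <= p0 by rewrite mulr_ge0 ?normal_peak_ge0 ?expR_ge0.
  have hB ij : (p0%:E <= P (X ij.1 ij.2 @^-1` B ij))%E.
    have := normX ij _ (mB ij); rewrite /distribution/= /pushforward => ->.
    by rewrite /B; case: ifP => _; apply: normal_prob_unit_itv_ge; lra.
  have -> : (n * d)%N = size (index_enum ('I_n * 'I_d)%type).
    by rewrite -sum1_size sum1_card card_prod !card_ord.
  elim: (index_enum _) => [|ij s IH]; first by rewrite big_nil.
  rewrite big_cons/= exprS EFinM; apply: lee_pmul => //.
  by rewrite lee_fin exprn_ge0.
- move=> w Ew; apply: newest_component_sign_event => // i j.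
  have := Ew (i, j); rewrite /= mem_index_enum => /(_ isT).
  rewrite /B/= mxE; case: ifP => _; rewrite /= in_itv/= => /andP[h1 h2];
    apply/andP; split; lra.
Qed.

End NewestComponentExpectation.

(** * Expected squared gradients are summable *)

Section Expectation.
Context (R : realType) (disp : measure_display) (T : measurableType disp)
  (P : probability T R).

(** The bound [Z <= (s + Z ^ 2 / s) / 2], optimized in [s]. *)
Lemma integral_le_sqrt (Z : T -> R) (b : R) :
  measurable_fun setT Z -> (forall w, 0 <= Z w) -> 0 <= b ->
  (\int[P]_w (Z w ^+ 2)%:E <= b%:E)%E ->
  (\int[P]_w (Z w)%:E <= (Num.sqrt b)%:E)%E.
Proof.
move=> mZ Z0 b0 hb.
have bound s : 0 < s ->
    (\int[P]_w (Z w)%:E <= (s / 2 + (2 * s)^-1 * b)%:E)%E.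
  move=> s0.
  have i0 : 0 <= (2 * s)^-1 by rewrite invr_ge0 mulr_ge0// ltW.
  have mZ2 : measurable_fun setT (fun w => ((2 * s)^-1 * Z w ^+ 2)%:E).
    apply/measurable_EFinP; apply: measurable_funM => //.
    exact: measurable_funX.
  apply: (@le_trans _ _ (\int[P]_w ((s / 2)%:E + ((2 * s)^-1 * Z w ^+ 2)%:E))%E).
    apply: ge0_le_integral => //.
    - by move=> w _; rewrite lee_fin.
    - exact/measurable_EFinP.
    - by apply: emeasurable_funD.
    move=> w _; rewrite -EFinD lee_fin -subr_ge0.
    have -> : s / 2 + (2 * s)^-1 * Z w ^+ 2 - Z w = (2 * s)^-1 * (s - Z w) ^+ 2.
      by field; rewrite gt_eqF.
    by rewrite mulr_ge0 ?sqr_ge0.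
  rewrite ge0_integralD//; last 2 first.
  - by move=> w _; rewrite lee_fin divr_ge0// ltW.
  - by move=> w _; rewrite lee_fin mulr_ge0 ?sqr_ge0.
  rewrite integral_cst//= probability_setT mule1 EFinD leeD2l//.
  under eq_integral do rewrite EFinM.
  rewrite ge0_integralZl_EFin//.
  - by rewrite EFinM lee_wpmul2l.
  - by move=> w _; rewrite lee_fin sqr_ge0.
  - by apply/measurable_EFinP; exact: measurable_funX.
(* For [b = 0] the infimum over [s > 0] is not attained. *)
have [b_eq0|bN0] := eqVneq b 0.
  rewrite b_eq0 sqrtr0; apply/lee_addgt0Pr => e e0.
  have := bound (2 * e); rewrite b_eq0 mulr0 addr0 mulrC mulfK// add0e; apply.
  by rewrite mulr_gt0.
have bp : 0 < b by rewrite lt_def bN0.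
have sp : 0 < Num.sqrt b by rewrite sqrtr_gt0.
apply: le_trans (bound _ sp) _; rewrite lee_fin.
rewrite -[X in _ + _ * X](sqr_sqrtr b0) le_eqVlt; apply/orP; left; apply/eqP.
by field; rewrite gt_eqF.
Qed.

Variables (n d : nat) (Q : nat -> 'I_n -> 'I_d -> {RV P >-> R}).
Hypothesis hQ : iid_std_normal
     (fun kij : nat * 'I_n * 'I_d => Q kij.1.1 kij.1.2 kij.2).

Lemma gaussian_mx_slice k : gaussian_mx (Q k).
Proof.
have [hN hI] := hQ; split; first by move=> ij; exact: (hN (k, ij.1, ij.2)).
move=> J B uJ mB.
pose h (ij : 'I_n * 'I_d) := (k, ij.1, ij.2).
have := hI (map h J) (fun kij => B (kij.1.2, kij.2)).
rewrite big_map/= map_inj_uniq; last by move=> [a b] [a' b'] [-> ->].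
move=> /(_ uJ (fun _ => mB _)) => E.
rewrite (eq_bigr (fun ij => P (Q k ij.1 ij.2 @^-1` B ij))) in E; last by case.
rewrite -E; congr (P _).
apply/seteqP; split => [w hw [[l i] j] /= /mapP[[i' j'] iJ [-> -> ->]]|w hw ij iJ].
  exact: (hw (i', j')).
case: ij iJ => i j iJ; apply: (hw (k, i, j)); by apply/mapP; exists (i, j).
Qed.

Definition past_cylinders k := cylinders (fun kij : nat * 'I_n * 'I_d => Q kij.1.1 kij.1.2 kij.2)
  (fun kij => (kij.1.1 < k)%N).
Definition present_cylinders k := cylinders (fun kij : nat * 'I_n * 'I_d => Q kij.1.1 kij.1.2 kij.2)
  (fun kij => kij.1.1 == k).

(** Conditionally on the past the gradient is a constant vector and [Q_k] is
    still Gaussian. *)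
Lemma expectation_newest_component (kappa : R) k (g : T -> 'cV[R]_n) :
  0 <= kappa ->
  (forall v, ((kappa * dot v v)%:E <=
    \int[P]_w (newest_component (random_mx (Q k) w) v)%:E)%E) ->
  mx_measurable (setT : set (g_sigma_algebraType (past_cylinders k))) g ->
  (\int[P]_w (kappa * dot (g w) (g w))%:E <=
   \int[P]_w (newest_component (random_mx (Q k) w) (g w))%:E)%E.
Proof.
move=> k0 hk mg.
apply: (@freezing _ _ _ P (past_cylinders k) (present_cylinders k)
  (fun w => (newest_component (random_mx (Q k) w.2) (g w.1))%:E)).
- exact: measurable_cylinders.
- exact: measurable_cylinders.
- apply: indep_cylinders; first by case: hQ.
  by move=> [[l i] j]/=; case: eqVneq => [->|]; rewrite ?ltnn ?andbF.
- apply/measurable_EFinP; apply: measurable_newest_component.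
    move=> i j; under eq_fun do rewrite mxE.
    apply: (measurableT_comp (f := Q k i j : g_sigma_algebraType (present_cylinders k) -> R)) => //.
    move=> _ B mB; rewrite setTI; apply: sub_sigma_algebra.
    exact: (@cylinders_preimage _ _ _ _ _ _ _ (k, i, j)).
  by move=> i j; exact: (measurableT_comp (mg i j)).
- by move=> w; rewrite lee_fin newest_component_ge0.
- apply/measurable_EFinP; apply: measurable_funM => //; exact: measurable_dot.
- by move=> w; rewrite lee_fin mulr_ge0 ?dot_ge0.
- by move=> w1 /=; exact: hk.
Qed.

Lemma mx_measurable_past m (beta c M1 M2 : R) (f : 'cV[R]_n -> R) x0 H0
    (Pinit : 'M[R]_(n, m))
    (Hdeg : nat -> T -> 'M[R]_m) (x : nat -> T -> 'cV[R]_n)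
    (H : nat -> T -> 'M[R]_m) k :
  classC2 f -> M1 <= M2 ->
  (forall k, history_measurable Q k (Hdeg k)) ->
  (forall w, subspace_qn_run beta c M1 M2 f x0 H0 Pinit
     (fun k => random_mx (Q k) w) (fun k => Hdeg k w)
     (fun k => x k w) (fun k => H k w)) ->
  mx_measurable (setT : set (g_sigma_algebraType (past_cylinders k)))
    (fun w => gradient f (x k w)).
Proof.
move=> hf M12 hHd hrun; have [_ dg _] := hf.
apply: (mx_measurable_continuous (F := gradient f)) => //; last first.
  by move=> z; exact/differentiable_continuous/dg.
have [] := @mx_measurable_run _ _ _ _ _ _ m Q _ (g_sigma_algebraType (past_cylinders k)) id
  beta c M1 M2 f x0 H0 Pinit Hdeg x H k hf M12 hHd hrun _ k (leqnn k) => //.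
move=> l i j lk _ B mB; rewrite setTI; apply: sub_sigma_algebra.
exact: (@cylinders_preimage _ _ _ _ _ _ _ (l, i, j)).
Qed.

Lemma mx_measurable_gradient m (beta c M1 M2 : R) (f : 'cV[R]_n -> R) x0 H0
    (Pinit : 'M[R]_(n, m))
    (Hdeg : nat -> T -> 'M[R]_m) (x : nat -> T -> 'cV[R]_n)
    (H : nat -> T -> 'M[R]_m) k :
  classC2 f -> M1 <= M2 ->
  (forall k, history_measurable Q k (Hdeg k)) ->
  (forall w, subspace_qn_run beta c M1 M2 f x0 H0 Pinit
     (fun k => random_mx (Q k) w) (fun k => Hdeg k w)
     (fun k => x k w) (fun k => H k w)) ->
  mx_measurable setT (fun w => gradient f (x k w)).
Proof.
move=> hf M12 hHd hrun i j _ B mB.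
have := mx_measurable_past (k := k) hf M12 hHd hrun i j measurableT mB.
exact: (smallest_sub (@sigma_algebra_measurable _ T) (@measurable_cylinders _ _ _ _ _ _ _)).
Qed.

(** Any lower bound of the expected newest component that is quadratic in the
    gradient makes the expected squared gradients summable, the telescoping
    decrease of [f] being at most [f x0 - fstar]. *)
Lemma sum_expected_gradient_le m (beta c M1 M2 L fstar kappa : R)
    (f : 'cV[R]_n -> R) x0 H0 (Pinit : 'M[R]_(n, m))
    (Hdeg : nat -> T -> 'M[R]_m) (x : nat -> T -> 'cV[R]_n)
    (H : nat -> T -> 'M[R]_m) k :
  (0 < m)%N -> 0 < beta < 1 -> 0 < c < 1 -> 0 < M1 -> M1 <= M2 -> 0 < L ->
  classC2 f ->
  (forall u w, enorm (gradient f u - gradient f w) <= L * enorm (u - w)) ->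
  (forall z, fstar <= f z) ->
  (forall j, enorm (col j Pinit) = 1) ->
  sym_between M1 M2 H0 -> (forall k w, sym_between M1 M2 (Hdeg k w)) ->
  (forall k, history_measurable Q k (Hdeg k)) ->
  (forall w, subspace_qn_run beta c M1 M2 f x0 H0 Pinit
     (fun k => random_mx (Q k) w) (fun k => Hdeg k w)
     (fun k => x k w) (fun k => H k w)) ->
  0 < kappa ->
  (forall k v, ((kappa * dot v v)%:E <=
    \int[P]_w (newest_component (random_mx (Q k) w) v)%:E)%E) ->
  (\sum_(j < k) \int[P]_w (enorm (gradient f (x j w)) ^+ 2)%:E <=
   ((c * Num.min 1 (2 * beta * (1 - c) / (m%:R * M2 * L)) * M1 * kappa)^-1 *
     (f x0 - fstar))%:E)%E.
Proof.
move=> m0 hb hc M10 M12 L0 hf hL hfs hP hH0 hHd hHm hrun kp hk.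
have [df _ _] := hf.
set K := c * _ * _.
have K0 : 0 < K.
  have M20 : 0 < M2 by apply: lt_le_trans M12.
  have m0R : 0 < m%:R :> R by rewrite ltr0n.
  case/andP: hb => b0 b1; case/andP: hc => c0 c1.
  by rewrite !mulr_gt0// lt_min ltr01/= divr_gt0 ?mulr_gt0// subr_gt0.
have mg j := mx_measurable_gradient j hf M12 hHm hrun.
pose N j w := newest_component (random_mx (Q j) w) (gradient f (x j w)).
have mN j : measurable_fun setT (N j).
  by apply: measurable_newest_component => //; exact: mx_measurable_random_mx.
have N0 j w : 0 <= N j w by exact: newest_component_ge0.
have hN j : (kappa%:E * \int[P]_w (enorm (gradient f (x j w)) ^+ 2)%:E <=
    \int[P]_w (N j w)%:E)%E.
  rewrite -ge0_integralZl_EFin//; last 3 first.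
  - by move=> w _; rewrite lee_fin sqr_ge0.
  - by apply/measurable_EFinP; apply: measurable_funX; exact: measurable_enorm.
  - exact: ltW.
  under eq_integral do rewrite -EFinM enorm_sqr.
  apply: expectation_newest_component => //; first exact: ltW.
  exact: (mx_measurable_past (k := j) hf M12 hHm hrun).
have sumN : (\sum_(j < k) \int[P]_w (N j w)%:E <= (K^-1 * (f x0 - fstar))%:E)%E.
  rewrite -ge0_integral_sum//; last 2 first.
  - by move=> j; exact/measurable_EFinP.
  - by move=> j w _; rewrite lee_fin.
  apply: (@le_trans _ _ (\int[P]_w (K^-1 * (f x0 - fstar))%:E)%E).
    apply: ge0_le_integral => //.
    - by move=> w _; apply: sume_ge0 => j _; rewrite lee_fin.
    - by apply: emeasurable_sum => j; exact/measurable_EFinP.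
    move=> w _; rewrite sumEFin lee_fin ler_pdivlMl//.
    exact: (newest_component_sum k m0 hb hc M10 M12 L0 df hL hfs hP hH0
      (fun k => hHd k w) (hrun w)).
  by rewrite integral_cst//= probability_setT mule1.
have -> : ((K * kappa)^-1 * (f x0 - fstar))%:E =
    ((kappa^-1)%:E * (K^-1 * (f x0 - fstar))%:E)%E.
  by rewrite -EFinM invfM; congr (_%:E); ring.
rewrite muleC lee_pdivlMr// muleC.
apply: le_trans sumN; rewrite ge0_sume_distrr.
  by apply: lee_sum => j _; exact: hN.
by move=> j _; apply: integral_ge0 => w _; rewrite lee_fin sqr_ge0.
Qed.

End Expectation.

(** * Convergence and rate *)

Lemma measurable_bigmin (R : realType) (disp : measure_display)
    (T : measurableType disp) (I : Type) (s : seq I) (z : T -> R)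
    (F : I -> T -> R) :
  measurable_fun setT z -> (forall i, measurable_fun setT (F i)) ->
  measurable_fun setT (fun w => \big[Num.min/z w]_(i <- s) F i w).
Proof.
move=> mz mF; elim: s => [|i s IH]; first by under eq_fun do rewrite big_nil.
by under eq_fun do rewrite big_cons; exact: measurable_minr.
Qed.

Lemma cvg_sqrt_summable (R : realType) (u : nat -> \bar R) (b : R) :
  (forall j, (0 <= u j)%E) ->
  (forall k, (\sum_(j < k) u j <= b%:E)%E) ->
  (fun j => (Num.sqrt (fine (u j)))%:E) @ \oo --> 0%E.
Proof.
move=> u0 ub.
have ufin j : u j = (fine (u j))%:E.
  rewrite fineK// ge0_fin_numE//; apply: (@le_lt_trans _ _ b%:E); last exact: ltry.
  apply: le_trans (ub j.+1); rewrite big_ord_recr/= leeDr//.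
  by apply: sume_ge0.
have v0 j : 0 <= fine (u j) by rewrite fine_ge0.
have cs : cvgn (series (fine \o u)).
  apply: nondecreasing_is_cvgn.
    by apply/nondecreasing_seqP => k; rewrite !seriesEord/= big_ord_recr/= lerDl.
  exists b => _ [k _ <-]; rewrite seriesEord/=.
  rewrite -lee_fin -sumEFin; apply: le_trans (ub k).
  by rewrite le_eqVlt; apply/orP; left; apply/eqP; apply: eq_bigr => j _; rewrite -ufin.
apply: cvg_EFin; first exact: nearW.
rewrite -[X in _ --> X](sqrtr0 R).
exact: (cvg_comp _ _ (cvg_series_cvg_0 cs) (@sqrt_continuous R 0)).
Qed.

Theorem theorem5 (R : realType)
  (n d m : nat) (hd : (0 < d)%N) (hm : (0 < m)%N) (hm_even : ~~ odd m)
  (hdn : (d < n)%N) (hmn : (m < n)%N)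
  (f : 'cV[R]_n -> R) (hf : classC2 f)
  (fstar : R) (hfstar : ereal_inf (range (fun x => (f x)%:E)) = fstar%:E)
  (L : R) (hL : 0 < L)
  (hlip : forall u v : 'cV[R]_n,
     enorm (gradient f u - gradient f v) <= L * enorm (u - v))
  (beta c M1 M2 : R) (hbeta : 0 < beta < 1) (hc : 0 < c < 1)
  (hM1 : 0 < M1) (hM12 : M1 <= M2)
  (C0 C : R) (hC0 : 0 < C0) (hC : 0 < C)
  (hC0n : norm_preservation_const n d C0)
  (hCn : opnorm_bound_const n d C)
  (x0 : 'cV[R]_n) (H0 : 'M[R]_m) (hH0 : sym_between M1 M2 H0)
  (Pinit : 'M[R]_(n, m)) (hPinit : forall j : 'I_m, enorm (col j Pinit) = 1)
  (disp : measure_display) (T : measurableType disp) (P : probability T R)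
  (Q : nat -> 'I_n -> 'I_d -> {RV P >-> R})
  (hQ : iid_std_normal
     (fun kij : nat * 'I_n * 'I_d => Q kij.1.1 kij.1.2 kij.2))
  (Hdeg : nat -> T -> 'M[R]_m)
  (hHdeg_meas : forall k, history_measurable Q k (Hdeg k))
  (hHdeg : forall k w, sym_between M1 M2 (Hdeg k w))
  (x : nat -> T -> 'cV[R]_n) (H : nat -> T -> 'M[R]_m)
  (hrun : forall w, subspace_qn_run beta c M1 M2 f x0 H0 Pinit
     (fun k => random_mx (Q k) w) (fun k => Hdeg k w)
     (fun k => x k w) (fun k => H k w)) :
  ((fun j : nat => 'E_P[fun w => enorm (gradient f (x j w))]%E) @ \oo --> 0%E) /\
  (forall eps : R, 0 < eps < 1 -> 0 < prob_level d C0 eps ->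
   forall k : nat,
     let abar := Num.min 1 (2 * beta * (1 - c) / (m%:R * M2 * L)) in
     ('E_P[fun w => \big[Num.min/enorm (gradient f (x 0%N w))]_(j < k.+1)
                      enorm (gradient f (x j w))] <=
      (Num.sqrt (k.+1%:R^-1 *
         (c * abar * M1 * ((1 - eps) * d%:R / (C * n%:R)) ^+ 2 *
          prob_level d C0 eps)^-1 *
         (f x0 - fstar)))%:E)%E).

Proof.
have n0 : (0 < n)%N by apply: leq_trans hdn.
have hfs := ereal_inf_range_le hfstar.
have summable kappa := @sum_expected_gradient_le R disp T P n d Q hQ m beta c M1 M2 L
  fstar kappa f x0 H0 Pinit Hdeg x H.
have mg j := mx_measurable_gradient j hf hM12 hHdeg_meas hrun.
have mZ j : measurable_fun setT (fun w => enorm (gradient f (x j w))).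
  exact: measurable_enorm.
have Z0 j w : 0 <= enorm (gradient f (x j w)) by exact: enorm_ge0.
have mZ2 j : measurable_fun setT (fun w => (enorm (gradient f (x j w)) ^+ 2)%:E).
  by apply/measurable_EFinP; exact: measurable_funX.
have Z20 j w : (0 <= (enorm (gradient f (x j w)) ^+ 2)%:E)%E.
  by rewrite lee_fin sqr_ge0.
split; last first.
  move=> eps heps hp k; lazy zeta; set abar := Num.min 1 _.
  set q := ((1 - eps) * d%:R / (C * n%:R)) ^+ 2.
  have q0 : 0 < q.
    by rewrite exprn_gt0// divr_gt0 ?mulr_gt0 ?ltr0n// subr_gt0; case/andP: heps.
  have qp : 0 < q * prob_level d C0 eps by rewrite mulr_gt0.
  have good k' v := expectation_newest_component_concentration v hd n0 hC heps hC0n hCn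
    (gaussian_mx_slice hQ k').
  have hsum := summable _ k.+1 hm hbeta hc hM1 hM12 hL hf hlip hfs hPinit hH0
    hHdeg hHdeg_meas hrun qp good.
  rewrite -/abar in hsum; set b := (c * abar * M1 * _)^-1 * _ in hsum.
  have -> : k.+1%:R^-1 * (c * abar * M1 * q * prob_level d C0 eps)^-1 * (f x0 - fstar)
      = k.+1%:R^-1 * b by rewrite /b -!mulrA.
  have b0 : 0 <= b.
    by rewrite -lee_fin; apply: le_trans hsum; apply: sume_ge0 => j _; exact: integral_ge0.
  set Z := fun w => _.
  have Zle w (j : 'I_k.+1) : Z w <= enorm (gradient f (x j w)) by exact: bigmin_le.
  have Zge w : 0 <= Z w by apply: le_bigmin.
  have mZm : measurable_fun setT Z by exact: measurable_bigmin.
  rewrite unlock; apply: integral_le_sqrt => //.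
    by rewrite mulr_ge0.
  have Zsum : (\int[P]_w (Z w ^+ 2)%:E <= \int[P]_w ((k.+1%:R^-1)%:E *
      \sum_(j < k.+1) (enorm (gradient f (x j w)) ^+ 2)%:E))%E.
    apply: ge0_le_integral => //.
    - by move=> w _; rewrite lee_fin sqr_ge0.
    - by apply/measurable_EFinP; exact: measurable_funX.
    - apply: emeasurable_funM; first exact: measurable_cst.
      by apply: emeasurable_sum.
    move=> w _; rewrite sumEFin -EFinM lee_fin ler_pdivlMl ?ltr0n//.
    rewrite -[k.+1 in leLHS](card_ord k.+1) -sum1_card natr_sum mulr_suml.
    apply: ler_sum => j _; rewrite mul1r ler_sqr ?nnegrE//.
  apply: le_trans Zsum _; rewrite ge0_integralZl_EFin//; last 2 first.
  - by move=> w _; apply: sume_ge0.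
  - by apply: emeasurable_sum.
  by rewrite ge0_integral_sum// EFinM; apply: lee_wpmul2l.
pose u j := (\int[P]_w (enorm (gradient f (x j w)) ^+ 2)%:E)%E.
have u0 j : (0 <= u j)%E by exact: integral_ge0.
pose kappa : R := (4 * n%:R)^-1 * (normal_peak 1 * expR (- 2)) ^+ (n * d).
have kp : 0 < kappa.
  rewrite mulr_gt0 ?invr_gt0 ?mulr_gt0 ?ltr0n//.
  by rewrite exprn_gt0// mulr_gt0 ?expR_gt0// normal_peak_gt0// oner_eq0.
have sign k' v := expectation_newest_component_sign v hd n0 (gaussian_mx_slice hQ k').
have ub k : (\sum_(j < k) u j <= _)%E :=
  summable kappa k hm hbeta hc hM1 hM12 hL hf hlip hfs hPinit hH0
    hHdeg hHdeg_meas hrun kp sign.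
have sq := cvg_sqrt_summable u0 ub.
apply: squeeze_cvge (cvg_cst 0%E) sq.
apply: nearW => j /=; rewrite unlock; apply/andP; split.
  by apply: integral_ge0 => w _; rewrite lee_fin.
apply: integral_le_sqrt => //; first by rewrite fine_ge0.
rewrite fineK// ge0_fin_numE//; apply: le_lt_trans (ltry _).
apply: le_trans (ub j.+1); rewrite big_ord_recr/= leeDr//.
by apply: sume_ge0.
Qed.
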